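(* Let $b>0$ and let $\Gamma:\mathfrak g=\bigoplus_{j\in\mathbb Z}\mathfrak g_j$ be a grading of $\mathfrak g$ that is $b$-optimal for $e$. Then the $e$-admissible pairs relative to $\Gamma$ are equivalent to each other. Moreover, they are equivalent to those arising from a Dynkin grading: there is an $\mathfrak{sl}_2$-triple $(e,h,f)$ of $\mathfrak g$ such that every $e$-admissible pair relative to $\Gamma$ is equivalent to every $e$-admissible pair relative to the Dynkin grading defined by $h$.
   Context: $\mathfrak g$ is a finite-dimensional simple Lie algebra over $\mathbb C$ with Killing form; $e\in\mathfrak g$ is nilpotent, $\mathfrak g^e$ its centralizer; $\perp$ is with respect to the Killing form. For a grading, $\mathfrak g_{\le k}=\bigoplus_{j\le k}\mathfrak g_j$, $\mathfrak g_{<k}=\bigoplus_{j<k}\mathfrak g_j$; a subspace is graded if it is the direct sum of its intersections with the $\mathfrak g_j$. For $b>0$, a grading $\Gamma:\mathfrak g=\bigoplus_{j}\mathfrak g_j$ is $b$-optimal for $e$ if $\mathfrak g_{<-b}\cap\mathfrak g^e=\{0\}$ and there is $a\in\mathbb N$, $a\ge2$, with $e\in\mathfrak g_a$ and $a\ge 2b$. A pair $(\mathfrak m,\mathfrak n)$ of subalgebras of $\mathfrak g$ is $e$-admissible relative to a $\mathbb Z$-grading $\Gamma:\mathfrak g=\bigoplus_{j\in\mathbb Z}\mathfrak g_j$ if for some integer $a>1$: (A1) $e\in\mathfrak g_a$; (A2) $\mathfrak m,\mathfrak n$ are graded and $\mathfrak g_{\le -a}\subseteq\mathfrak m\subseteq\mathfrak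 n\subseteq\mathfrak g_{<0}$; (A3) $\mathfrak m^\perp\cap[\mathfrak g,e]=[\mathfrak n,e]$; (A4) $\mathfrak n\cap\mathfrak g^e=\{0\}$; (A5) $[\mathfrak n,\mathfrak m]\subseteq\mathfrak m$; (A6) $\dim\mathfrak m+\dim\mathfrak n=\dim\mathfrak g-\dim\mathfrak g^e$. It is $e$-admissible if it is so relative to some $\mathbb Z$-grading. Two $e$-admissible pairs $(\mathfrak m,\mathfrak n)$, $(\mathfrak m',\mathfrak n')$ are comparable if there is a $\mathbb Z$-grading relative to which both are $e$-admissible and either $\mathfrak m\subseteq\mathfrak m'\subseteq\mathfrak n'\subseteq\mathfrak n$ or $\mathfrak m'\subseteq\mathfrak m\subseteq\mathfrak n\subseteq\mathfrak n'$. Two $e$-admissible pairs are equivalent if they are joined by a finite sequence of $e$-admissible pairs in which any two consecutive ones are comparable. An $\mathfrak{sl}_2$-triple $(e,h,f)$ satisfies $[h,e]=2e$, $[e,f]=h$, $[h,f]=-2f$; the Dynkin grading defined by $h$ is the grading of $\mathfrak g$ by the eigenvalues of $\mathrm{ad}\,h$. *)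

(* Defs.v *)
From HB Require Import structures.
From mathcomp Require Import all_boot all_order all_algebra.

Set Implicit Arguments.
Unset Strict Implicit.
Unset Printing Implicit Defensive.

Import Order.TTheory GRing.Theory Num.Theory.
Local Open Scope ring_scope.

HB.mixin Record hasLieBracket (K : fieldType) L of Vector K L := {
  lie : L -> L -> L;
  lie_is_linearl : forall y, linear (fun x => lie x y);
  lie_is_linearr : forall x, linear (lie x);
  liexx : forall x, lie x x = 0;
  lie_jacobi : forall x y z,
    lie x (lie y z) + lie y (lie z x) + lie z (lie x y) = 0
}.

#[short(type="lieAlgType")]
HB.structure Definition LieAlgebra (K : fieldType) :=
  {L of hasLieBracket K L & Vector K L}.

Section Adjoint.
Variables (K : fieldType) (L : lieAlgType K).

HB.instance Definition _ (x : L) :=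
  GRing.isSemilinear.Build K L L *:%R (lie x)
    (GRing.semilinear_linear (lie_is_linearr x)).

Definition ad (x : L) : 'End(L) := linfun (lie x).

Lemma adE (x y : L) : ad x y = lie x y.
Proof. exact: lfunE. Qed.

Definition lie_subalgebra (V : {vspace L}) : Prop :=
  forall x y, x \in V -> y \in V -> lie x y \in V.

Definition lie_ideal (V : {vspace L}) : Prop :=
  forall x y, y \in V -> lie x y \in V.

Definition simple_lie : Prop :=
  (exists x y : L, lie x y != 0) /\
  (forall V : {vspace L}, lie_ideal V -> V = 0%VS \/ V = fullv).

Definition lfun_trace (f : 'End(L)) : K :=
  \tr (passmx.mxof (vbasis (fullv : {vspace L})) (vbasis (fullv : {vspace L})) f).

Definition killing (x y : L) : K := lfun_trace (ad x \o ad y)%VF.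

Definition killing_orth (V : {vspace L}) (x : L) : Prop :=
  forall y, y \in V -> killing x y = 0.

Definition lie_nilpotent (e : L) : Prop :=
  exists n : nat, forall x, iter n (ad e) x = 0.

Definition centralizer (e : L) : {vspace L} := lker (ad e).

(* [V, e], which equals [e, V] as a subspace. *)
Definition lie_img (V : {vspace L}) (e : L) : {vspace L} := (ad e @: V)%VS.

Definition sl2_triple (e h f : L) : Prop :=
  [/\ lie h e = e *+ 2, lie e f = h & lie h f = - (f *+ 2)].

End Adjoint.

Section Gradings.
Variables (K : fieldType) (L : lieAlgType K).
Implicit Types (G : int -> {vspace L}) (V : {vspace L}).

(* Membership in the sum of the (infinite) subfamily of the G j with P j. *)
Definition in_gsum G (P : pred int) (x : L) : Prop :=
  exists s : seq int, x \in (\sum_(j <- s | P j) G j)%VS.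

Definition is_direct_sum V G : Prop :=
  (forall x, x \in V <-> in_gsum G predT x) /\
  (forall s : seq int, uniq s -> directv (\sum_(j <- s) G j)%VS).

Definition is_grading G : Prop :=
  is_direct_sum fullv G /\
  (forall i j x y, x \in G i -> y \in G j -> lie x y \in G (i + j)).

Definition graded_subspace G V : Prop :=
  is_direct_sum V (fun j => V :&: G j)%VS.

Definition dynkin_grading (h : L) : int -> {vspace L} :=
  fun j => passmx.leigenspace (ad h) j%:~R.

Definition b_optimal (R : realDomainType) (b : R) (e : L) G : Prop :=
  (forall x, in_gsum G (fun j => j%:~R < - b) x -> x \in centralizer e ->
     x = 0) /\
  (exists a : nat, [/\ (2 <= a)%N, e \in G a%:Z & 2 * b <= a%:R]).

(* The pair (p.1, p.2) plays the role of (m, n). *)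
Definition admissible_rel (e : L) G (p : {vspace L} * {vspace L}) : Prop :=
  let: (m, n) := p in
  lie_subalgebra m /\ lie_subalgebra n /\
  exists a : int, 1 < a /\
  [/\ e \in G a,
      [/\ graded_subspace G m /\ graded_subspace G n,
          forall x, in_gsum G (fun j => j <= - a) x -> x \in m,
          (m <= n)%VS &
          forall x, x \in n -> in_gsum G (fun j => j < 0) x],
      forall x, (killing_orth m x /\ x \in lie_img fullv e) <->
                x \in lie_img n e &
      [/\ (n :&: centralizer e = 0)%VS,
          forall x y, x \in n -> y \in m -> lie x y \in m &
          (\dim m + \dim n =
           \dim (fullv : {vspace L}) - \dim (centralizer e))%N]].

Definition admissible (e : L) (p : {vspace L} * {vspace L}) : Prop :=
  exists G, is_grading G /\ admissible_rel e G p.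

Definition comparable_pairs (e : L) (p q : {vspace L} * {vspace L}) : Prop :=
  exists G, is_grading G /\ admissible_rel e G p /\ admissible_rel e G q /\
    ([/\ (p.1 <= q.1)%VS, (q.1 <= q.2)%VS & (q.2 <= p.2)%VS] \/
     [/\ (q.1 <= p.1)%VS, (p.1 <= p.2)%VS & (p.2 <= q.2)%VS]).

Definition equivalent_pairs (e : L) (p q : {vspace L} * {vspace L}) : Prop :=
  exists (k : nat) (c : nat -> {vspace L} * {vspace L}),
    [/\ c 0 = p, c k = q,
        forall i, (i <= k)%N -> admissible e (c i) &
        forall i, (i < k)%N -> comparable_pairs e (c i) (c i.+1)].

End Gradings.

(* Main.v *)
From HB Require Import structures.
Require Import Defs.
From mathcomp Require Import all_boot all_order all_algebra.
From mathcomp Require Import reals.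
From mathcomp Require Import complex.
From mathcomp Require Import boolp ring lra zify.

Set Implicit Arguments.
Unset Strict Implicit.
Unset Printing Implicit Defensive.

Import Order.TTheory GRing.Theory Num.Theory.
Local Open Scope ring_scope.

(** Write the grading as the eigenspace decomposition of a derivation [T], so
    that graded subspaces are the [T]-stable ones.  Only one consequence of
    [b]-optimality matters: [ad e] is injective in degrees [< - a / 2].

    For a fixed grading let [M] be the part of degree [< - a / 2], [V] the part
    of degree [- a / 2], and [W] a complement of the centralizer of [e] in [V].
    Then [(M, M + W)] is admissible, and a suitable [W] links it to a given
    pair [(m, n)] through [(m :&: M, M + W + n)].  Two choices of [W] with a
    common hyperplane [n0] are both comparable to [(M + l, M + n0)], where [l]
    is the line orthogonal to [n0] for the form [killing (lie e x) y].

    To reach a Dynkin grading, complete [e] to an sl2-triple with [h] of degree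
    [0]; the grading and the [h]-eigenspaces form a bigrading [(i, j)].  Deform
    [T] to [ad h] through the combinations [2 k T + (N - k) a (ad h)].  If [N]
    is divisible enough, no bidegree crosses the middle degree strictly between
    [k] and [k + 1], so for odd [k] the canonical pair of the [k]-th grading is
    admissible relative to the neighbouring gradings as well.

    The Killing form is nondegenerate by Cartan's criterion: if it vanished,
    tracing [ad x] against the derivation acting by the conjugate eigenvalues
    of [ad x] would make every [ad x] nilpotent, against Engel's theorem. *)

(** * Stable subspaces and generalized eigenspaces *)

Section StableSubspaces.
Variables (K : fieldType) (V : vectType K).
Implicit Types (f g : 'End(V)) (U : {vspace V}).

(** The kernel of [ad e] lies in bidegrees with [2 i >= - a], by the hypothesis on the given
    grading, and [j >= 0], by sl2-theory. Every proper mixture of the two degrees therefore puts it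
    strictly above the middle degree: the injectivity hypothesis holds along the whole chain, and
    there the complement [W] is the full middle part. Only in the given grading may the centralizer
    of [e] meet the middle degree, so that [W] is a choice and different choices have to be joined.
    A pair moves from one grading to another as the same two subspaces: (A3) to (A6) do not mention
    the grading, so only (A1) and (A2) are tested again, and (A2) follows when no bidegree changes
    sides of the middle. A bidegree off the line [2 i = a j] meets the middle degree at a single
    real parameter; taking [N] to be twice a factorial forces that parameter to be an even integer,
    which is why odd [k] carry the pairs and even [k] the comparisons. *)

Definition stable f U : Prop := forall x, x \in U -> f x \in U.

Lemma stableD f U W : stable f U -> stable f W -> stable f (U + W).
Proof.
move=> sU sW x /memv_addP[u uU [w wW ->]]; rewrite linearD.
by apply: memv_add; [apply: sU | apply: sW].
Qed.

Lemma stableI f U W : stable f U -> stable f W -> stable f (U :&: W).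
Proof.
by move=> sU sW x /memv_capP[xU xW]; rewrite memv_cap sU // sW.
Qed.

Lemma stable0 f : stable f 0.
Proof. by move=> x; rewrite !memv0 => /eqP->; rewrite linear0. Qed.

Lemma stablef f : stable f fullv.
Proof. by move=> x _; exact: memvf. Qed.

(** [f - c j] kills the component of index [j] and multiplies every other one by a nonzero scalar,
    so induction extracts the tail and the head follows by subtraction. *)
Lemma eigensum_stable f U (I : eqType) (c : I -> K) (s : seq I) (x : I -> V) :
  {in s &, injective c} -> uniq s ->
  {in s, forall i, f (x i) = c i *: x i} -> stable f U ->
  \sum_(i <- s) x i \in U -> {in s, forall i, x i \in U}.
Proof.
elim: s x => [|j s IHs] x // cinj /= /andP[js us] xE sU sumU.
have cne i : i \in s -> c i - c j != 0.
  move=> i_s; rewrite subr_eq0; apply: contraNneq js => cij.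
  by rewrite -(cinj i j _ _ cij) // inE ?eqxx ?i_s ?orbT.
have tailU : {in s, forall i, x i \in U}.
  move=> i i_s.
  have : {in s, forall k, (c k - c j) *: x k \in U}.
    apply: (IHs (fun k => (c k - c j) *: x k)) => //.
    - by move=> k l ks ls; apply: cinj; rewrite inE ?ks ?ls orbT.
    - move=> k ks; rewrite linearZ /= xE ?inE ?ks ?orbT //.
      by rewrite !scalerA mulrC.
    - have := memvB (sU _ sumU) (memvZ (c j) sumU).
      rewrite big_cons linearD linear_sum scalerDr scaler_sumr /=.
      rewrite xE ?mem_head // opprD addrACA subrr add0r -sumrB.
      rewrite (eq_big_seq (fun k => (c k - c j) *: x k)) // => k ks.
      by rewrite xE ?inE ?ks ?orbT // scalerBl.
  move/(_ i i_s)/(memvZ (c i - c j)^-1).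
  by rewrite scalerA mulVf ?cne // scale1r.
move=> i; rewrite inE => /predU1P[->|]; last exact: tailU.
have sU' : \sum_(k <- s) x k \in U.
  by rewrite big_seq; apply: memv_suml => k ks; exact: tailU.
by move: (memvB sumU sU'); rewrite big_cons addrK.
Qed.

(** The common source of three operators: the degree derivation of a grading, the projections onto
    its pieces, and the conjugated semisimple part of a derivation. *)
Lemma scaled_lfun_exists (I : eqType) (s : seq I) (W : I -> {vspace V})
    (c : I -> K) :
  uniq s ->
  (forall x : I -> V, {in s, forall i, x i \in W i} ->
     \sum_(i <- s) x i = 0 -> {in s, forall i, x i = 0}) ->
  (\sum_(i <- s) W i)%VS = fullv ->
  exists S : 'End(V), {in s, forall i, forall v, v \in W i -> S v = c i *: v}.
Proof.
move=> us indep full.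
pose p i := sumv_pi (\sum_(i <- s) W i)%VS i.
exists (\sum_(i <- s) c i *: p i) => j js v vW.
rewrite sum_lfunE.
have pE : {in s, forall i, p i v = if i == j then v else 0}.
  move=> i is_; apply/eqP; rewrite -subr_eq0; apply/eqP.
  apply: (indep (fun i => p i v - (if i == j then v else 0))) is_.
    move=> k ks; apply: memvB; first exact: memv_sum_pi.
    by case: eqP => [->|_] //; exact: mem0v.
  rewrite sumrB /p sumv_pi_uniq_sum ?filter_predT // ?full ?memvf //.
  rewrite (bigD1_seq j) //= eqxx big1 ?addr0 ?subrr // => k /negPf-> //.
rewrite (eq_big_seq (fun i => if i == j then c j *: v else 0)).
  by rewrite (bigD1_seq j) //= eqxx big1 ?addr0 // => k /negPf->.
by move=> i is_; rewrite scale_lfunE pE //; case: eqP => [->|]; rewrite ?scaler0.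
Qed.

Definition geneig (f : 'End(V)) (a : K) (n : nat) (v : V) : Prop :=
  iter n (fun x => f x - a *: x) v = 0.

Definition shift f a : 'End(V) := f - a *: \1%VF.

Lemma shiftE f a v : shift f a v = f v - a *: v.
Proof. by rewrite /shift add_lfunE opp_lfunE scale_lfunE id_lfunE. Qed.

Lemma geneigE f a n v : geneig f a n v <-> iter n (shift f a) v = 0.
Proof.
by rewrite /geneig (@eq_iter _ _ (shift f a)) // => x; rewrite shiftE.
Qed.

Lemma iter_linear f n : linear (fun v => iter n f v).
Proof. by elim: n => [|n IHn] k u v //; rewrite 1!iterS /= IHn linearP. Qed.

HB.instance Definition _ f n := GRing.isSemilinear.Build K V V *:%R (iter n f)
  (GRing.semilinear_linear (iter_linear f n)).

Definition gker f a n : {vspace V} := lker (linfun (iter n (shift f a))).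

Lemma mem_gker f a n v : (v \in gker f a n) = (iter n (shift f a) v == 0).
Proof. by rewrite memv_ker lfunE. Qed.

Lemma gkerP f a n v : reflect (geneig f a n v) (v \in gker f a n).
Proof. by rewrite mem_gker; apply: (iffP eqP) => /geneigE. Qed.

Lemma gkerS f a m n v : (m <= n)%N -> v \in gker f a m -> v \in gker f a n.
Proof.
move=> le_mn; rewrite !mem_gker -(subnK le_mn) iterD => /eqP->.
by rewrite linear0.
Qed.

Lemma gkerSr f a n v : (v \in gker f a n.+1) = (shift f a v \in gker f a n).
Proof. by rewrite !mem_gker iterSr. Qed.

Lemma shift_comm f a b v : shift f a (shift f b v) = shift f b (shift f a v).
Proof.
rewrite !shiftE !linearB !linearZ /= !scalerA (mulrC b a).
by rewrite -!addrA; congr (_ + _); rewrite addrCA.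
Qed.

Lemma stable_gker f a n b : stable (shift f b) (gker f a n).
Proof.
move=> x; rewrite !mem_gker => /eqP x0.
suff -> : iter n (shift f a) (shift f b x) = shift f b (iter n (shift f a) x).
  by rewrite x0 linear0.
by elim: n {x0} => //= n ->; rewrite shift_comm.
Qed.

(** By induction on [m + n] both [shift f a v] and [shift f b v] vanish, and they differ by a
    nonzero multiple of [v]. *)
Lemma gker_disjoint f a b m n v : a != b ->
  v \in gker f a m -> v \in gker f b n -> v = 0.
Proof.
move=> ab; have [k] := ubnP (m + n); elim: k => // k IHk in m n v *.
case: m => [|m]; first by rewrite (mem_gker _ _ 0) => _ /eqP.
case: n => [|n]; first by rewrite (mem_gker _ _ 0) => _ _ /eqP.
rewrite addSn addnS ltnS => mnk va vb.
have ha : shift f a v = 0.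
  apply: (IHk m n.+1); first by rewrite addnS.
    by rewrite -gkerSr.
  exact: stable_gker.
have hb : shift f b v = 0.
  apply: (IHk m.+1 n); first by rewrite addSn.
    exact: stable_gker.
  by rewrite -gkerSr.
have : shift f a v - shift f b v = 0 by rewrite ha hb subrr.
rewrite !shiftE opprB addrC addrA subrK -scalerBl => /eqP.
by rewrite scaler_eq0 subr_eq0 eq_sym (negPf ab) => /eqP.
Qed.

Lemma gker_indep f n (s : seq K) (x : K -> V) : uniq s ->
  {in s, forall a, x a \in gker f a n} -> \sum_(a <- s) x a = 0 ->
  {in s, forall a, x a = 0}.
Proof.
elim: s x => [|b s IHs] x //= /andP[bs us] xW; rewrite big_cons => sum0.
have tl : {in s, forall a, x a = 0}.
  move=> a as_; apply: (@gker_disjoint f a b n n).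
  - by apply: contraNneq bs => <-.
  - by apply: xW; rewrite inE as_ orbT.
  rewrite mem_gker; apply/eqP.
  apply: (IHs (fun a => iter n (shift f b) (x a))) as_ => //.
    move=> c cs; have: x c \in gker f c n by apply: xW; rewrite inE cs orbT.
    move=> xc; suff: forall m, iter m (shift f b) (x c) \in gker f c n by apply.
    by elim=> //= k IHk; apply: stable_gker.
  have /(congr1 (iter n (shift f b))) := sum0.
  rewrite linearD linear0 linear_sum /=.
  have: x b \in gker f b n by apply: xW; rewrite mem_head.
  by rewrite mem_gker => /eqP->; rewrite add0r.
move=> a; rewrite inE => /predU1P[->|]; last exact: tl.
by move: sum0; rewrite big_seq big1 ?addr0.
Qed.

Lemma gker_shift_surj f a b n u : a != b -> u \in gker f a n ->
  exists2 w, w \in gker f a n & shift f b w = u.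
Proof.
move=> ab; elim: n u => [|n IHn] u un.
  by exists 0; rewrite ?mem0v ?linear0 //; move: un; rewrite mem_gker /= => /eqP->.
have [w wn wE] := IHn _ (etrans (esym (gkerSr f a n u)) un).
have ab0 : a - b != 0 by rewrite subr_eq0.
(* [shift f b - shift f a] is the scalar [a - b], and [shift f b w = shift f a u], so [shift f b]
   sends [u - w] to [(a - b) *: u]. *)
exists ((a - b)^-1 *: (u - w)).
  by apply/memvZ/memvB => //; apply: gkerS wn.
rewrite linearZ /= linearB /= wE !shiftE.
have -> : f u - b *: u - (f u - a *: u) = (a - b) *: u.
  by rewrite opprB addrC addrA subrK scalerBl.
by rewrite scalerA mulVf // scale1r.
Qed.

(* The factor [f - r] is peeled off by solving it on all generalized
   eigenspaces other than that of [r]. *)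
Lemma gker_span f (Q : V -> Prop) (s t : seq K) :
  Q 0 -> (forall x y, Q x -> Q y -> Q (x + y)) ->
  (forall a n x, a \in s -> (n <= size s)%N -> x \in gker f a n -> Q x) ->
  {subset t <= s} -> (size t <= size s)%N ->
  forall v, foldr (fun r u => shift f r u) v t = 0 -> Q v.
Proof.
move=> Q0 QD Qg.
pose G n v := exists2 x : K -> V, {in undup s, forall a, x a \in gker f a n} &
  v = \sum_(a <- undup s) x a.
suff main : {subset t <= s} -> forall v,
    foldr (fun r u => shift f r u) v t = 0 -> G (size t) v.
  move=> ts st v /(main ts)[x xG ->].
  rewrite big_seq; elim/big_ind: _ => // a as_; apply: (Qg a (size t)) => //.
    by rewrite -mem_undup.
  exact: xG.
elim: t => [|r t IHt] ts v /=.
  move=> ->; exists (fun=> 0); first by move=> *; exact: mem0v.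
  by rewrite big1.
have foldC u : shift f r (foldr (fun r u => shift f r u) u t) =
    foldr (fun r u => shift f r u) (shift f r u) t.
  by elim: t {IHt ts} => //= q t IH; rewrite shift_comm IH.
rewrite foldC => /IHt[|x xG vE]; first by move=> q qt; rewrite ts // inE qt orbT.
have rs : r \in undup s by rewrite mem_undup ts ?mem_head.
have /choice [y yP] a : exists w, a \in undup s -> a != r ->
    w \in gker f a (size t) /\ shift f r w = x a.
  case: (boolP ((a \in undup s) && (a != r))) => [/andP[as_ ar]|h].
    have [w w1 w2] := gker_shift_surj ar (xG _ as_).
    by exists w.
  by exists 0 => as_ ar; rewrite as_ ar in h.
(* Once the solutions [y a] are removed from [v], [shift f r] sends the remainder to [x r]: the
   exponent grows by one at [r] only. *)
pose z a := if a == r then v - \sum_(a <- undup s | a != r) y a else y a.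
exists z => [a as_|]; last first.
  rewrite (bigD1_seq r) ?undup_uniq //= /z eqxx.
  rewrite [X in _ + X](eq_bigr y) ?subrK // => a /negPf-> //.
rewrite /z; case: (eqVneq a r) => [->|ar]; last first.
  by apply: (@gkerS _ _ (size t)) => //; have [] := yP a as_ ar.
rewrite gkerSr linearB /= vE (bigD1_seq r) ?undup_uniq //= linear_sum /=.
have -> : \sum_(a <- undup s | a != r) shift f r (y a) =
    \sum_(a <- undup s | a != r) x a.
  rewrite big_seq_cond [RHS]big_seq_cond; apply: eq_bigr => c /andP[cs cr].
  by have [] := yP c cs cr.
rewrite addrK; exact: xG.
Qed.

End StableSubspaces.

Section ClosedField.
Variables (K : closedFieldType) (V : vectType K).
Implicit Types (f : 'End(V)).

(** Cayley-Hamilton, with the characteristic polynomial split into linear factors applied one after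
    the other. *)
Lemma mx_annihilated n (A : 'M[K]_n) : exists s : seq K,
  forall u : 'rV_n, foldr (fun r u => u *m A - r *: u) u s = 0.
Proof.
case: n A => [|n] A; first by exists [::] => u; apply/rowP => -[].
have [s sE] := closed_field_poly_normal (char_poly A).
exists s => u; have := Cayley_Hamilton A.
rewrite sE (monicP (char_poly_monic A)) scale1r rmorph_prod /= => CH.
rewrite -[RHS](mulmx0 _ u) -CH.
elim: s {sE CH} => [|r s IHs] /=; first by rewrite big_nil mulmx1.
rewrite big_cons IHs -rmorph_prod /= comm_horner_mx2.
rewrite [in RHS]rmorphB /= horner_mx_X horner_mx_C rmorph_prod.
set P := \prod_(i <- s) _.
by rewrite -[P * _]/(P *m _) mulmxBr mulmxBr mul_mx_scalar mulmxA scalemxAr.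
Qed.

End ClosedField.

(** * Derivations and the Killing form *)

Section LieBasics.
Variables (K : fieldType) (L : lieAlgType K).
Implicit Types (x y z : L) (f g : 'End(L)) (U : {vspace L}).

Lemma lieDl x y z : lie (x + y) z = lie x z + lie y z.
Proof. by have := lie_is_linearl z 1 x y; rewrite /= !scale1r. Qed.

Lemma lie0l z : lie 0 z = 0 :> L.
Proof. by apply: (addIr (lie 0 z)); rewrite -lieDl !add0r. Qed.

Lemma lieZl a x z : lie (a *: x) z = a *: lie x z.
Proof. by have := lie_is_linearl z a x 0; rewrite /= !addr0 lie0l addr0. Qed.

Lemma lieDr x y z : lie x (y + z) = lie x y + lie x z.
Proof. exact: linearD. Qed.

Lemma lie0r x : lie x 0 = 0 :> L.
Proof. exact: linear0. Qed.

Lemma lieZr a x z : lie x (a *: z) = a *: lie x z.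
Proof. exact: linearZ. Qed.

Lemma lieC x y : lie x y = - lie y x.
Proof.
apply/eqP; rewrite -addr_eq0; have := liexx (x + y).
by rewrite lieDl !lieDr !liexx add0r addr0 => ->.
Qed.

Lemma lieNl x y : lie (- x) y = - lie x y.
Proof. by rewrite -scaleN1r lieZl scaleN1r. Qed.

Lemma lieNr x y : lie x (- y) = - lie x y.
Proof. exact: linearN. Qed.

Lemma lieBl x y z : lie (x - y) z = lie x z - lie y z.
Proof. by rewrite lieDl lieNl. Qed.

Lemma lieBr x y z : lie x (y - z) = lie x y - lie x z.
Proof. exact: linearB. Qed.

Lemma lie_leibniz x y z :
  lie x (lie y z) = lie (lie x y) z + lie y (lie x z).
Proof.
apply/eqP; rewrite -subr_eq0 opprD addrA.
rewrite (lieC (lie x y) z) opprK -(lieNr y) -(lieC z x) -(lie_jacobi x y z).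
by rewrite addrAC.
Qed.

Lemma adD x y : ad (x + y) = ad x + ad y.
Proof. by apply/lfunP => z; rewrite add_lfunE !adE lieDl. Qed.

Lemma adZ a x : ad (a *: x) = a *: ad x.
Proof. by apply/lfunP => z; rewrite scale_lfunE !adE lieZl. Qed.

Definition derivation f : Prop :=
  forall x y, f (lie x y) = lie (f x) y + lie x (f y).

Lemma ad_derivation x : derivation (ad x).
Proof. by move=> y z; rewrite !adE lie_leibniz. Qed.

Lemma ad_derE f x : derivation f -> ad (f x) = (f \o ad x)%VF - (ad x \o f)%VF.
Proof.
move=> df; apply/lfunP => y.
by rewrite add_lfunE opp_lfunE !comp_lfunE !adE df addrK.
Qed.

Lemma ad_lie x y : ad (lie x y) = (ad x \o ad y)%VF - (ad y \o ad x)%VF.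
Proof. by rewrite -(adE x y) (ad_derE _ (ad_derivation x)). Qed.

Lemma derivation_lin a b f g : derivation f -> derivation g ->
  derivation (a *: f + b *: g).
Proof.
move=> df dg x y; rewrite !add_lfunE !scale_lfunE df dg !lieDl !lieDr.
by rewrite !lieZl !lieZr !scalerDr addrACA.
Qed.

Lemma lfun_traceD f g : lfun_trace (f + g) = lfun_trace f + lfun_trace g.
Proof.
rewrite /lfun_trace; set B := vbasis fullv.
by have := passmx.mxof_linear B B 1 f g; rewrite !scale1r => ->; rewrite mxtraceD.
Qed.

Lemma lfun_traceZ a f : lfun_trace (a *: f) = a * lfun_trace f.
Proof.
have tr0 : lfun_trace (0 : 'End(L)) = 0.
  by have /eqP := lfun_traceD 0 0; rewrite addr0 -subr_eq0 opprD addNKr oppr_eq0 => /eqP.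
move: tr0; rewrite -[a *: f]addr0 /lfun_trace passmx.mxof_linear mxtraceD.
by rewrite mxtraceZ => ->; rewrite addr0.
Qed.

Lemma lfun_traceB f g : lfun_trace (f - g) = lfun_trace f - lfun_trace g.
Proof. by rewrite lfun_traceD -scaleN1r lfun_traceZ mulN1r. Qed.

Lemma lfun_traceC f g : lfun_trace (f \o g) = lfun_trace (g \o f).
Proof.
rewrite /lfun_trace.
by rewrite !(passmx.mxof_comp _ _ (vbasisP fullv)) mxtrace_mulC.
Qed.

Lemma killingE x y : killing x y = lfun_trace (ad x \o ad y).
Proof. by []. Qed.

Lemma killingC x y : killing x y = killing y x.
Proof. exact: lfun_traceC. Qed.

Lemma killingDl x y z : killing (x + y) z = killing x z + killing y z.
Proof. by rewrite /killing adD comp_lfunDl lfun_traceD. Qed.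

Lemma killingZl a x z : killing (a *: x) z = a * killing x z.
Proof. by rewrite /killing adZ -comp_lfunZl lfun_traceZ. Qed.

Lemma killingDr x y z : killing x (y + z) = killing x y + killing x z.
Proof. by rewrite killingC killingDl !(killingC x). Qed.

Lemma killingZr a x z : killing x (a *: z) = a * killing x z.
Proof. by rewrite killingC killingZl (killingC x). Qed.

Lemma killing0l x : killing 0 x = 0.
Proof. by rewrite -(scale0r 0) killingZl mul0r. Qed.

Lemma killing0r x : killing x 0 = 0.
Proof. by rewrite killingC killing0l. Qed.

Lemma killingNl x y : killing (- x) y = - killing x y.
Proof. by rewrite -scaleN1r killingZl mulN1r. Qed.

Lemma killingBl x y z : killing (x - y) z = killing x z - killing y z.
Proof. by rewrite killingDl killingNl. Qed.

Lemma trace_der f x y : derivation f ->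
  lfun_trace (ad (f x) \o ad y) = - lfun_trace (ad x \o ad (f y)).
Proof.
move=> df; rewrite !(ad_derE _ df) comp_lfunDl comp_lfunDr.
rewrite comp_lfunNl comp_lfunNr !lfun_traceB !comp_lfunA opprB.
by rewrite -comp_lfunA (lfun_traceC f).
Qed.

Lemma killing_der f x y : derivation f -> killing (f x) y = - killing x (f y).
Proof. exact: trace_der. Qed.

Lemma killing_lie x y z : killing (lie x y) z = - killing y (lie x z).
Proof. by rewrite -!(adE x) (killing_der _ _ (ad_derivation x)). Qed.

(** Values of [killing x] on a basis of [U]: the orthogonal of [U] becomes a kernel, and
    rank-nullity bounds its dimension from below. *)
Definition kill_row U x : 'rV[K]_(\dim U) :=
  \row_i killing x (vbasis U)`_i.

Lemma kill_row_linear U : linear (kill_row U).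
Proof.
by move=> a x y; apply/rowP => i; rewrite !mxE killingDl killingZl.
Qed.

HB.instance Definition _ U := GRing.isSemilinear.Build K L _ *:%R (kill_row U)
  (GRing.semilinear_linear (kill_row_linear U)).

Definition kperp U : {vspace L} := lker (linfun (kill_row U)).

Lemma kperpP U x : reflect (killing_orth U x) (x \in kperp U).
Proof.
rewrite memv_ker lfunE /=; apply: (iffP eqP) => [/rowP x0 y|xU].
  move/coord_vbasis => ->; elim/big_ind: _ => [|u v u0 v0|i _].
  - exact: killing0r.
  - by rewrite killingDr u0 v0 addr0.
  - by rewrite killingZr; have := x0 i; rewrite !mxE => ->; rewrite mulr0.
by apply/rowP => i; rewrite !mxE xU // vbasis_mem // mem_nth ?size_tuple.
Qed.

Lemma dim_kperp_ge U : (\dim {:L} <= \dim (kperp U) + \dim U)%N.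
Proof.
rewrite -(limg_ker_dim (linfun (kill_row U)) fullv) capfv leq_add2l.
by apply: leq_trans (dimvS (subvf _)) _; rewrite dimvf dim_matrix [X in (X <= _)%N]mul1r.
Qed.

Definition killing_nondeg : Prop := forall x, (forall y, killing x y = 0) -> x = 0.

(** The lower bound holds for [U] and for a complement of [U]. The two orthogonals meet in a vector
    orthogonal to everything, hence in zero, so both bounds are sharp. *)
Lemma dim_kperp U : killing_nondeg -> (\dim (kperp U) + \dim U = \dim {:L})%N.
Proof.
move=> nd; apply/eqP; rewrite eqn_leq dim_kperp_ge andbT.
have h := dim_kperp_ge U^C%VS.
have : (\dim (kperp U) + \dim (kperp U^C) <= \dim {:L})%N.
  rewrite -dimv_sum_cap (_ : kperp U :&: kperp U^C = 0)%VS.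
    by rewrite dimv0 addn0 dimvS // subvf.
  apply/eqP; rewrite -subv0; apply/subvP => x /memv_capP[/kperpP xU /kperpP xC].
  rewrite memv0; apply/eqP/nd => y.
  have /memv_addP[u uU [w wU ->]] : y \in (U + U^C)%VS by rewrite addv_complf memvf.
  by rewrite killingDr xU // xC // addr0.
move: h; rewrite dimv_compl.
have : (\dim U <= \dim {:L})%N by rewrite dimvS // subvf.
move: (\dim _) (\dim (kperp _)) (\dim (kperp _)) (\dim U) => a b c d h1 h2 h3.
have h4 : (d <= c)%N by rewrite -(leq_add2r (a - d)) subnKC.
by apply: leq_trans h3; rewrite leq_add2l.
Qed.

Lemma kperpK U : killing_nondeg -> kperp (kperp U) = U.
Proof.
move=> nd; apply/esym/eqP; rewrite eqEdim.
apply/andP; split.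
  apply/subvP => x xU; apply/kperpP => y /kperpP yU.
  by rewrite killingC yU.
rewrite -(leq_add2l (\dim (kperp U))) addnC dim_kperp //.
by rewrite dim_kperp.
Qed.

End LieBasics.

(** * Engel's theorem and Cartan's criterion *)

Section ClosedFieldEigen.
Variables (K : closedFieldType) (V : vectType K).
Implicit Types (f : 'End(V)) (U : {vspace V}).

Lemma lfun_annihilated f : exists2 s : seq K, (0 < size s)%N &
  forall v, foldr (fun r u => shift f r u) v s = 0.
Proof.
pose B := vbasis {:V}.
have BP : basis_of {:V} B := vbasisP _.
have [s sE] := mx_annihilated (passmx.mxof B B f).
(* The extra root makes the list nonempty, so that true eigenvectors, which have exponent one, fall
   under the bound [size s] on exponents. *)
exists (0 :: s) => // v /=; suff -> : foldr (fun r u => shift f r u) v s = 0.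
  exact: linear0.
apply/eqP; rewrite -(passmx.rVof_eq0 BP); apply/eqP.
rewrite -[RHS](sE (passmx.rVof B v)).
elim: {sE} s => //= r s <-; rewrite shiftE.
rewrite -(passmx.rVof_app _ BP) -scaleNr addrC passmx.rVof_linear.
by rewrite addrC scaleNr.
Qed.

(** The factors [f - r] are applied to [v] one by one; the last nonzero vector obtained is an
    eigenvector, and stability keeps it in [U]. *)
Lemma stable_eigenvector f U (s : seq K) v : stable f U -> v \in U -> v != 0 ->
  foldr (fun r u => shift f r u) v s = 0 ->
  exists a u, [/\ a \in s, u \in U, u != 0 & f u = a *: u].
Proof.
move=> sU; elim: s v => [|r s IHs] v vU v0 /= fv.
  by rewrite fv eqxx in v0.
have [w0|w0] := eqVneq (foldr (fun r u => shift f r u) v s) 0.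
  have [a [u [as_ uU u0 uE]]] := IHs v vU v0 w0.
  by exists a, u; rewrite inE as_ orbT.
exists r, (foldr (fun r u => shift f r u) v s); split; rewrite ?mem_head //.
  elim: s {IHs fv w0} => //= q s IH; rewrite shiftE.
  by apply: memvB; [apply: sU | apply: memvZ].
by apply/eqP; rewrite -subr_eq0 -shiftE fv.
Qed.

(** A nonzero generalized eigenspace is stable, so it contains a true eigenvector, whose eigenvalue
    is [0]; hence only the generalized eigenspace of [0] survives. *)
Lemma nilpotent_of_eigenvalues f :
  (forall a u, u != 0 -> f u = a *: u -> a = 0) ->
  exists n, forall v, iter n f v = 0.
Proof.
move=> f0; have [s _ sE] := lfun_annihilated f.
exists (size s) => v.
apply: (@gker_span _ _ f (fun v => iter (size s) f v = 0) s s _ _ _ _ _ v (sE v)) => //.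
- exact: linear0.
- by move=> x y xE yE; rewrite linearD /= xE yE addr0.
move=> a n x _ ns xa.
have [->|x0] := eqVneq x 0; first exact: linear0.
suff a0 : a = 0.
  move: xa; rewrite a0 => /(gkerS ns)/gkerP.
  rewrite /geneig => <-; apply: eq_iter => u; by rewrite scale0r subr0.
have sg : stable f (gker f a n).
  move=> u ua; have -> : f u = shift f 0 u by rewrite shiftE scale0r subr0.
  exact: stable_gker.
have [b [u [_ ua u0 uE]]] := stable_eigenvector sg xa x0 (sE x).
have b0 := f0 b u u0 uE; apply/eqP; apply: contraNT u0 => a0.
apply/eqP; apply: (@gker_disjoint _ _ f a 0 n 1) => //.
by rewrite mem_gker /= shiftE uE b0 subrr.
Qed.

End ClosedFieldEigen.

Lemma lfun_trace_eigen (K : closedFieldType) (L : lieAlgType K) (f : 'End(L)) :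
  exists2 s : seq K, lfun_trace f = \sum_(r <- s) r &
    forall r, r \in s <-> exists2 v, v != 0 & f v = r *: v.
Proof.
pose B := vbasis {:L}; have BP : basis_of {:L} B := vbasisP _.
rewrite /lfun_trace -/B; set A := passmx.mxof B B f.
have [s sE] := closed_field_poly_normal (char_poly A).
rewrite (monicP (char_poly_monic A)) scale1r in sE.
have szs : size s = \dim {:L}.
  by apply/succn_inj; rewrite -(size_char_poly A) sE size_prod_XsubC.
exists s.
  have [d0|d0] := posnP (\dim {:L}).
    have : s = [::] by apply/size0nil; rewrite szs.
    by move=> ->; rewrite big_nil /mxtrace big1 // => i; have := ltn_ord i; rewrite {2}d0.
  have coefE : (\prod_(r <- s) ('X - r%:P))`_(\dim {:L}).-1 = - \sum_(r <- s) r.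
    by rewrite -szs coefPn_prod_XsubC // szs -lt0n.
  by apply: oppr_inj; rewrite -coefE -sE char_poly_trace.
move=> r; rewrite -root_prod_XsubC -sE -eigenvalue_root_char; split.
  case/eigenvalueP => u uE u0; exists (passmx.vecof B u).
    by rewrite passmx.vecof_eq0.
  rewrite (passmx.hom_vecof _ BP) -/A uE.
  by have := passmx.vecof_linear B r u 0; rewrite !addr0 => ->;
     rewrite (_ : passmx.vecof B 0 = 0) ?addr0 //; apply/eqP; rewrite passmx.vecof_eq0.
case=> v v0 vE; apply/eigenvalueP; exists (passmx.rVof B v).
  rewrite -(passmx.rVof_app _ BP) vE.
  by have := passmx.rVof_linear B r v 0; rewrite !addr0 => ->;
     rewrite (_ : passmx.rVof B 0 = 0) ?addr0 //; apply/eqP; rewrite passmx.rVof_eq0.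
by rewrite passmx.rVof_eq0.
Qed.

Lemma lfun_trace_nilpotent (K : closedFieldType) (L : lieAlgType K) (f : 'End(L)) :
  (forall a u, u != 0 -> f u = a *: u -> a = 0) -> lfun_trace f = 0.
Proof.
move=> f0; have [s -> sP] := lfun_trace_eigen f.
by rewrite big_seq big1 // => r /sP[v v0 /f0 ->].
Qed.

Section Derived.
Variables (K : fieldType) (L : lieAlgType K).

(** The derived ideal is nonzero, hence everything. Put as an induction principle, so that additive
    properties need checking on brackets only. *)
Lemma simple_perfect (Q : L -> Prop) : simple_lie L ->
  Q 0 -> (forall x y, Q x -> Q y -> Q (x + y)) ->
  (forall x y, Q (lie x y)) -> forall x, Q x.
Proof.
move=> [[x0 [y0 xy0]] sL] Q0 QD Ql.
pose D := (\sum_(i < \dim {:L}) (ad (vbasis {:L})`_i @: fullv))%VS.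
have DP x y : lie x y \in D.
  rewrite (coord_vbasis (memvf x)).
  elim/big_rec: _ => [|i u _ uD]; first by rewrite lie0l mem0v.
  rewrite lieDl memvD // lieZl memvZ //; apply: (subvP (sumv_sup i _ (subvv _))) => //.
  by rewrite -adE memv_img // memvf.
have [D0|DL] := sL D (fun x y _ => DP x y).
  by have := DP x0 y0; rewrite D0 memv0 (negPf xy0).
move=> x; have : x \in D by rewrite DL memvf.
case/memv_sumP => u uP ->; elim/big_ind: _ => // i _.
by have /memv_imgP[v _ ->] := uP i isT; rewrite adE.
Qed.

Lemma simple_center (x : L) : simple_lie L -> (forall y, lie y x = 0) -> x = 0.
Proof.
move=> [[y [z yz0]] sL] x0; apply/eqP; apply: contraNT yz0 => nx.
have idx : lie_ideal <[x]>%VS.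
  by move=> u v /vlineP[k ->]; rewrite lieZr x0 scaler0 mem0v.
have [h|xf] := sL _ idx.
  by move: (memv_line x); rewrite h memv0 (negPf nx).
have /vlineP[k ->] : z \in <[x]>%VS by rewrite xf memvf.
by rewrite lieZr x0 scaler0.
Qed.

(* A subalgebra acting triangularly is enlarged one dimension at a time. *)
Lemma engel : (forall x : L, exists n, forall v, iter n (ad x) v = 0) ->
  (exists x : L, x != 0) -> exists2 v : L, v != 0 & forall x, lie x v = 0.
Proof.
move=> nil [x0 x0n].
(* Ranging over all stable [A < B] replaces quotient modules: [U < L] yields a vector normalizing
   [U], and [0 < L] yields the conclusion. *)
pose eng (U : {vspace L}) := lie_subalgebra U /\
  forall A B : {vspace L}, (A <= B)%VS -> A != B ->
    (forall x, x \in U -> stable (ad x) A) ->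
    (forall x, x \in U -> stable (ad x) B) ->
    exists v, [/\ v \in B, v \notin A & forall x, x \in U -> lie x v \in A].
suff main k : (k <= \dim {:L})%N -> exists U : {vspace L}, eng U /\ \dim U = k.
  have [U [[_ eU] dU]] := main _ (leqnn _).
  have UL : U = fullv by apply/eqP; rewrite eqEdim subvf dU leqnn.
  case: (eU 0%VS fullv (subvf _)) => //.
  - by apply/eqP => h; move: (memvf x0); rewrite -h memv0 (negPf x0n).
  - by move=> x _; exact: stable0.
  - by move=> x _; exact: stablef.
  move=> v [_ v0 vP]; exists v; first by rewrite -memv0.
  by move=> x; apply/eqP; rewrite -memv0; apply: vP; rewrite UL memvf.
elim: k => [_|k IHk kL].
  exists 0%VS; rewrite dimv0; split=> //; split.
    by move=> x y _; rewrite !memv0 => /eqP->; rewrite lie0r.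
  move=> A B AB nAB _ _.
  have /subvPn[v vB vA] : ~~ (B <= A)%VS.
    by apply: contra nAB => BA; rewrite eqEsubv AB.
  by exists v; split=> // x; rewrite memv0 => /eqP->; rewrite lie0l mem0v.
have [U [[sU eU] dU]] := IHk (ltnW kL).
have [x [_ xU Ux]] : exists x, [/\ x \in (fullv : {vspace L}), x \notin U &
    forall u, u \in U -> lie u x \in U].
  apply: eU; first exact: subvf.
  - by apply: contraTneq kL => UL; rewrite -dU UL ltnn.
  - by move=> u uU v vU; rewrite adE; apply: sU.
  - by move=> *; exact: stablef.
exists (U + <[x]>)%VS; split; last first.
  rewrite dimv_disjoint_sum ?dU ?dim_vline ?addn1.
    by rewrite (_ : x != 0) ?addn1 //; apply: contraNneq xU => ->; exact: mem0v.
  apply/eqP; rewrite -subv0; apply/subvP => v /memv_capP[vU /vlineP[c vE]].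
  rewrite memv0 vE scaler_eq0; apply/orP; left; apply: contraNT xU => c0.
  by rewrite -(scale1r x) -(mulVf c0) -scalerA -vE memvZ.
split.
  move=> _ _ /memv_addP[u uU [_ /vlineP[c ->] ->]] /memv_addP[w wU [_ /vlineP[d ->] ->]].
  apply: (subvP (addvSl U <[x]>%VS)).
  rewrite lieDl !lieDr !lieZl !lieZr liexx !scaler0 addr0.
  rewrite (lieC x w) scalerN; apply: memvB; last by apply/memvZ/Ux.
  by apply: memvD; [apply: sU | apply/memvZ/Ux].
move=> A B AB nAB sA sB.
have sub u : u \in U -> u \in (U + <[x]>)%VS by apply/subvP/addvSl.
have xx : x \in (U + <[x]>)%VS by apply: (subvP (addvSr _ _)); exact: memv_line.
have [v [vB vA Uv]] := eU A B AB nAB (fun u uU => sA u (sub u uU))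
                           (fun u uU => sB u (sub u uU)).
(* As [x] normalizes [U], every iterate of [v] under [ad x] is still sent into [A] by [U]; the last
   iterate outside [A] is sent there by [x] as well. *)
have iterP n : (forall u, u \in U -> lie u (iter n (ad x) v) \in A) /\
    iter n (ad x) v \in B.
  elim: n => [|n [IH1 IH2]]; first by split.
  split; last by rewrite iterS; apply: (sB x).
  move=> u uU; rewrite iterS adE lie_leibniz memvD //.
    by apply: IH1; apply: Ux.
  by rewrite -(adE x); apply: (sA x xx); apply: IH1.
have [N NP] := nil x.
have exn : exists n, iter n (ad x) v \in A by exists N; rewrite NP mem0v.
case: (@ex_minnP (fun n => iter n (ad x) v \in A) exn) => -[|m] mA mmin.
  by rewrite mA in vA.
exists (iter m (ad x) v); split; first by have [] := iterP m.
  by apply/negP => /mmin; rewrite ltnn.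
move=> _ /memv_addP[u uU [_ /vlineP[c ->] ->]].
rewrite lieDl lieZl memvD //; first by have [h _] := iterP m; apply: h.
by rewrite memvZ // -adE.
Qed.

End Derived.

Section CartanCriterion.
Variables (K : numClosedFieldType) (L : lieAlgType K).
Implicit Types (x y z : L) (f : 'End(L)).

Lemma derivation_gker f a b m n u v : derivation f ->
  u \in gker f a m -> v \in gker f b n -> lie u v \in gker f (a + b) (m + n).
Proof.
move=> df; have [k] := ubnP (m + n); elim: k => // k IHk in m n u v *.
case: m => [|m]; first by rewrite (mem_gker f a 0) => _ /eqP /= -> _; rewrite lie0l mem0v.
case: n => [|n].
  by rewrite (mem_gker f b 0) => _ _ /eqP /= ->; rewrite lie0r mem0v.
rewrite addSn addnS ltnS => lk um vn.
rewrite gkerSr.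
have -> : shift f (a + b) (lie u v) = lie (shift f a u) v + lie u (shift f b v).
  rewrite !shiftE df lieBl lieBr lieZl lieZr scalerDl opprD.
  by rewrite addrACA.
apply: memvD.
  by rewrite -addnS; apply: IHk; rewrite ?addnS // -gkerSr.
by rewrite -addSn; apply: IHk; rewrite ?addSn // -gkerSr.
Qed.

(* The semisimple part of [f] with conjugated eigenvalues is again a
   derivation because conjugation is additive. *)
Lemma conj_derivation f : derivation f -> exists S : 'End(L),
  [/\ derivation S, forall x, S (f x) = f (S x) &
      forall a u, f u = a *: u -> S u = a^* *: u].
Proof.
move=> df; have [s s0 sE] := lfun_annihilated f.
(* A bracket of generalized eigenvectors has the sum of their eigenvalues, and its exponent is at
   most the sum of theirs: hence the doubled bound here and the sums in [t]. *)
pose N := (size s + size s)%N.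
pose t := undup (s ++ [seq a + b | a <- s, b <- s]).
have st a : a \in s -> a \in t by rewrite mem_undup mem_cat => ->.
have full : (\sum_(a <- t) gker f a N)%VS = fullv.
  apply/eqP; rewrite eqEsubv subvf /=; apply/subvP => v _.
  apply: (@gker_span _ _ f (fun v => v \in (\sum_(a <- t) gker f a N)%VS)
    s s _ _ _ _ _ v (sE v)) => //.
  - exact: mem0v.
  - by move=> x y; apply: memvD.
  move=> a n x as_ ns xa.
  rewrite (bigD1_seq a) ?undup_uniq ?st //=; apply: (subvP (addvSl _ _)).
  by apply: gkerS xa; apply: leq_trans ns (leq_addr _ _).
have [S SP] : exists S : 'End(L),
    {in t, forall a v, v \in gker f a N -> S v = a^* *: v}.
  apply: scaled_lfun_exists full; first exact: undup_uniq.
  by move=> y; apply: gker_indep; exact: undup_uniq.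
have Sg a n u : a \in s -> (n <= size s)%N -> u \in gker f a n -> S u = a^* *: u.
  move=> as_ ns ua; apply: SP; first exact: st.
  by apply: gkerS ua; apply: leq_trans ns (leq_addr _ _).
exists S; split.
- move=> x y.
  apply: (@gker_span _ _ f (fun x => S (lie x y) = lie (S x) y + lie x (S y))
    s s _ _ _ _ _ x (sE x)) => //.
  + by rewrite !(lie0l, linear0) addr0.
  + by move=> x1 x2 h1 h2; rewrite lieDl !linearD /= h1 h2 !lieDl addrACA.
  move=> a m u as_ ms ua.
  apply: (@gker_span _ _ f (fun y => S (lie u y) = lie (S u) y + lie u (S y))
    s s _ _ _ _ _ y (sE y)) => //.
  + by rewrite !(lie0r, linear0) addr0.
  + by move=> x1 x2 h1 h2; rewrite !linearD /= h1 h2 addrACA.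
  move=> b n v bs ns vb.
  rewrite (Sg a m u) // (Sg b n v) // lieZl lieZr -scalerDl -rmorphD /=.
  apply: SP.
    by rewrite mem_undup mem_cat; apply/orP; right; apply: allpairs_f.
  by apply: gkerS (derivation_gker df ua vb); apply: leq_add.
- move=> x; apply: (@gker_span _ _ f (fun x => S (f x) = f (S x))
    s s _ _ _ _ _ x (sE x)) => //.
  + by rewrite !linear0.
  + by move=> x1 x2 h1 h2; rewrite !linearD /= h1 h2.
  move=> a n u as_ ns ua; rewrite (Sg a n u) // linearZ /=.
  apply: (Sg a n) => //; rewrite -[f u](subrK (a *: u)) -shiftE.
  by apply: memvD; [apply: stable_gker | apply: memvZ].
move=> a u uE; have [->|u0] := eqVneq u 0; first by rewrite linear0 scaler0.
(* The line of [u] contains an eigenvector with eigenvalue in [s], which places [a] in [s]. *)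
have sl : stable f <[u]>%VS.
  by move=> v /vlineP[c ->]; rewrite linearZ /= uE scalerA memvZ // memv_line.
have [b [v [bs /vlineP[c vE] v0 fv]]] := stable_eigenvector sl (memv_line u) u0 (sE u).
have ab : a = b.
  apply/eqP; rewrite -subr_eq0.
  have : (a - b) *: v == 0 by rewrite scalerBl -fv vE [f _]linearZ /= uE !scalerA mulrC subrr.
  by rewrite scaler_eq0 (negPf v0) orbF.
rewrite ab; apply: (Sg b 1%N) => //.
by rewrite mem_gker /= shiftE uE ab subrr.
Qed.

(** Since [S] is a derivation, the trace of [ad [y, z] \o S] is [- killing y (S z) = 0], so by
    perfectness [ad x \o S] has trace zero. Its eigenvalues are squared moduli, hence all vanish. *)
Lemma killing0_nilpotent x : simple_lie L -> (forall y z : L, killing y z = 0) ->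
  exists n, forall v, iter n (ad x) v = 0.
Proof.
move=> sL k0; apply: nilpotent_of_eigenvalues => a u u0 uE.
have [S [dS SC Su]] := conj_derivation (ad_derivation x).
have trT : lfun_trace (ad x \o S) = 0.
  apply: (@simple_perfect _ L (fun x => lfun_trace (ad x \o S) = 0)) => //.
  - by rewrite -(scale0r 0) adZ -comp_lfunZl lfun_traceZ mul0r.
  - by move=> y z hy hz; rewrite adD comp_lfunDl lfun_traceD hy hz addr0.
  move=> y z; rewrite ad_lie comp_lfunDl comp_lfunNl lfun_traceB.
  have -> : lfun_trace ((ad z \o ad y) \o S) = lfun_trace (ad y \o (S \o ad z)).
    by rewrite -comp_lfunA lfun_traceC comp_lfunA.
  rewrite -comp_lfunA -lfun_traceB.
  have -> : (ad y \o (ad z \o S))%VF - (ad y \o (S \o ad z))%VF =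
      (-1) *: (ad y \o ad (S z))%VF.
    by rewrite (ad_derE _ dS) scaleN1r comp_lfunDr comp_lfunNr opprB.
  by rewrite lfun_traceZ -/(killing y (S z)) k0 mulr0.
have [s sE sP] := lfun_trace_eigen (ad x \o S)%VF.
have s_ge0 r : r \in s -> 0 <= r.
  move=> /sP[v v0 vE]; have [t _ tE] := lfun_annihilated (ad x).
  (* [S] commutes with [ad x], so the eigenspace of [ad x \o S] for [r] contains an eigenvector of
     [ad x]; if its eigenvalue is [b], then [r = b * b^*]. *)
  have stT : stable (ad x) (lker ((ad x \o S)%VF - r *: \1%VF)).
    move=> w; rewrite !memv_ker !add_lfunE !opp_lfunE !scale_lfunE !id_lfunE.
    rewrite !comp_lfunE !subr_eq0 => /eqP wE.
    by rewrite SC wE linearZ.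
  have vT : v \in lker ((ad x \o S)%VF - r *: \1%VF).
    by rewrite memv_ker add_lfunE opp_lfunE scale_lfunE id_lfunE vE subrr.
  have [b [w [_ wT w0 wE]]] := stable_eigenvector stT vT v0 (tE v).
  move: wT; rewrite memv_ker !add_lfunE !opp_lfunE !scale_lfunE !id_lfunE.
  rewrite comp_lfunE (Su _ _ wE) linearZ /= wE scalerA -scalerBl scaler_eq0 (negPf w0).
  by rewrite orbF subr_eq0 mulrC => /eqP <-; exact: mul_conjC_ge0.
have aas : a * a^* \in s.
  by apply/sP; exists u => //; rewrite comp_lfunE (Su _ _ uE) linearZ /= uE scalerA mulrC.
move: sE; rewrite trT => /esym/eqP; rewrite big_seq psumr_eq0 //.
move/allP/(_ _ aas); rewrite aas /= => /eqP/eqP.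
by rewrite mul_conjC_eq0 => /eqP.
Qed.

Lemma simple_killing_nondeg : simple_lie L -> killing_nondeg L.
Proof.
move=> sL; have [[x0 [y0 xy0]] ideals] := sL.
have idr : lie_ideal (kperp (fullv : {vspace L})).
  move=> x y /kperpP yP; apply/kperpP => z _.
  by rewrite killing_lie yP ?memvf ?oppr0.
have [rad0|radL] := ideals _ idr.
  move=> x xP; apply/eqP; rewrite -memv0 -rad0; apply/kperpP => y _; exact: xP.
have k0 y z : killing y z = 0.
  have /kperpP yP : y \in kperp (fullv : {vspace L}) by rewrite radL memvf.
  exact: yP (memvf z).
have [v v0 vP] : exists2 v : L, v != 0 & forall x, lie x v = 0.
  apply: engel; first by move=> x; exact: killing0_nilpotent.
  by exists (lie x0 y0).
by move: v0; rewrite (simple_center sL vP) eqxx.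
Qed.

End CartanCriterion.

Global Opaque killing lfun_trace.

(** * Gradings as eigenspace decompositions *)

Section SeqSums.
Variables (K : fieldType) (V : vectType K) (I : eqType).
Implicit Types (W : I -> {vspace V}) (s : seq I) (P : pred I).

Lemma seq_sumv_sup W s P j : j \in s -> P j ->
  (W j <= \sum_(i <- s | P i) W i)%VS.
Proof. by move=> js Pj; rewrite (big_rem j) //= Pj addvSl. Qed.

Lemma seq_sumv_sub W s P U : (forall j, j \in s -> P j -> (W j <= U)%VS) ->
  (\sum_(i <- s | P i) W i <= U)%VS.
Proof.
move=> WU; rewrite big_seq_cond; apply: (big_ind (fun S => S <= U)%VS).
- exact: sub0v.
- by move=> A B AU BU; rewrite subv_add AU.
- by move=> j /andP[js Pj]; apply: WU.
Qed.

Lemma seq_sumv_decomp W s P x : uniq s -> x \in (\sum_(i <- s | P i) W i)%VS ->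
  exists2 y : I -> V, (forall i, i \in s -> P i -> y i \in W i) &
    x = \sum_(i <- s | P i) y i.
Proof.
elim: s x => [|j s IHs] x /=.
  by rewrite big_nil memv0 => _ /eqP->; exists (fun=> 0); rewrite ?big_nil.
case/andP=> js us; rewrite big_cons.
have [Pj|nPj] := boolP (P j).
  case/memv_addP => u uW [v /(IHs _ us)[y yW ->] ->].
  exists (fun i => if i == j then u else y i) => [i|].
    by rewrite inE; case: eqVneq => [->|_] //= i_s Pi; apply: yW.
  rewrite big_cons Pj eqxx; congr (_ + _).
  rewrite -!(big_filter s P); apply: eq_big_seq => i; rewrite mem_filter => /andP[_ i_s].
  by case: eqVneq => // ij; rewrite -ij i_s in js.
case/(IHs _ us) => y yW ->; exists y => [i|]; last by rewrite big_cons (negPf nPj).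
by rewrite inE => /predU1P[->|i_s]; [rewrite (negPf nPj) | apply: yW].
Qed.

Lemma directv_seqP W s : uniq s ->
  directv (\sum_(i <- s) W i) <->
  (forall x : I -> V, {in s, forall i, x i \in W i} ->
     \sum_(i <- s) x i = 0 -> {in s, forall i, x i = 0}).
Proof.
case: s => [|i0 s'] //; first by rewrite directvE /= !big_nil dimv0.
set s := i0 :: s' => us.
have -> : directv (\sum_(i <- s) W i) = directv (\sum_(k < size s) W (nth i0 s k)).
  by rewrite !directvE /= !(big_nth i0) !big_mkord.
split=> [/directv_sum_independent dW x xW|indep].
  rewrite (big_nth i0) big_mkord => /dW h i is_.
  have is_' : (index i s < size s)%N by rewrite index_mem.
  have := h _ (Ordinal is_') isT; rewrite /= nth_index //; apply.
  by move=> k _; apply/xW/mem_nth.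
apply/directv_sum_independent => u uW u0 k _.
pose x i := if insub (index i s) is Some k then u k else 0 : V.
have xE (l : 'I_(size s)) : x (nth i0 s l) = u l.
  by rewrite /x index_uniq // valK.
rewrite -xE; apply: (indep x); last exact: mem_nth.
  move=> i is_; have is_' : (index i s < size s)%N by rewrite index_mem.
  by have := uW (Ordinal is_') isT; rewrite -xE /= nth_index.
by rewrite (big_nth i0) big_mkord -[RHS]u0; apply: eq_bigr => l _; apply: xE.
Qed.

Lemma indep_notin_sum W s j (y : I -> V) :
  (forall x : I -> V, {in j :: s, forall i, x i \in W i} ->
     \sum_(i <- j :: s) x i = 0 -> {in j :: s, forall i, x i = 0}) ->
  j \notin s -> {in s, forall i, y i \in W i} ->
  \sum_(i <- s) y i \in W j -> \sum_(i <- s) y i = 0.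
Proof.
move=> indep js yW; set x := \sum_(i <- s) y i => xj.
pose z i := if i == j then - x else y i.
have zE : z j = - x by rewrite /z eqxx.
apply/eqP; rewrite -oppr_eq0 -zE; apply/eqP; apply: indep (mem_head _ _).
  move=> i; rewrite inE /z; case: eqVneq => [->|_] /=; first by rewrite memvN.
  exact: yW.
rewrite big_cons zE (eq_big_seq y) ?addNr // => i i_s.
by rewrite /z; case: eqVneq => // ij; rewrite -ij i_s in js.
Qed.

End SeqSums.

Section Gsum.
Variables (K : fieldType) (L : lieAlgType K).
Implicit Types (G : int -> {vspace L}) (P : pred int) (x : L).

Lemma in_gsum_mem G P j x : x \in G j -> P j -> in_gsum G P x.
Proof. by move=> xG Pj; exists [:: j]; rewrite big_cons Pj big_nil addv0. Qed.

Lemma in_gsum0 G P : in_gsum G P 0.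
Proof. by exists [::]; rewrite mem0v. Qed.

Lemma in_gsumD G P x y : in_gsum G P x -> in_gsum G P y -> in_gsum G P (x + y).
Proof. by case=> s xs [t yt]; exists (s ++ t); rewrite big_cat memv_add. Qed.

Lemma in_gsum_ind G P (Q : L -> Prop) :
  Q 0 -> (forall x y, Q x -> Q y -> Q (x + y)) ->
  (forall j x, P j -> x \in G j -> Q x) -> forall x, in_gsum G P x -> Q x.
Proof.
move=> Q0 QD QG x [s]; elim: s x => [|j s IHs] x.
  by rewrite big_nil memv0 => /eqP->.
rewrite big_cons; case: ifP => [Pj|_]; last exact: IHs.
by case/memv_addP => u uG [v /IHs Qv ->]; apply: QD => //; apply: QG uG.
Qed.

Lemma in_gsum_decomp G P x : in_gsum G P x -> exists (s : seq int) (y : int -> L),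
  [/\ uniq s, forall j, j \in s -> P j /\ y j \in G j & x = \sum_(j <- s) y j].
Proof.
case=> s xs; pose t := [seq j <- undup s | P j].
have ut : uniq t by rewrite filter_uniq ?undup_uniq.
have [y yG xE] : exists2 y : int -> L,
    (forall i, i \in t -> true -> y i \in G i) & x = \sum_(i <- t) y i.
  apply: seq_sumv_decomp => //; apply: subvP xs.
  apply: seq_sumv_sub => j js Pj.
  by apply: seq_sumv_sup; rewrite ?mem_filter ?mem_undup ?Pj.
exists t, y; split=> // j jt; split; last exact: yG.
by move: jt; rewrite mem_filter => /andP[].
Qed.

Lemma in_gsum_support G : (forall x, in_gsum G predT x) ->
  exists2 s : seq int, uniq s & (\sum_(j <- s) G j)%VS = fullv.
Proof.
move=> Gf; pose b := (vbasis {:L}).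
have /choice [S SP] (i : 'I_(\dim {:L})) : exists s, b`_i \in (\sum_(j <- s) G j)%VS.
  exact: Gf.
pose s := undup (flatten [seq S i | i <- enum 'I_(\dim {:L})]).
exists s; first exact: undup_uniq.
apply/eqP; rewrite eqEsubv subvf /=; apply/subvP => x _.
rewrite (coord_vbasis (memvf x)); apply: memv_suml => i _; apply: memvZ.
apply: subvP (SP i); apply: seq_sumv_sub => j js _.
apply: seq_sumv_sup => //; rewrite mem_undup; apply/flattenP; exists (S i) => //.
by apply/map_f; rewrite mem_enum.
Qed.

End Gsum.

Section DiagonalDerivations.
Variables (K : numFieldType) (L : lieAlgType K).
Implicit Types (T f : 'End(L)) (U : {vspace L}) (P : pred int) (x y h : L).

Definition egr T : int -> {vspace L} := fun j => passmx.leigenspace T j%:~R.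

(** Diagonalizability with integer eigenvalues. *)
Definition idiag T : Prop := forall x, in_gsum (egr T) predT x.

Lemma dynkin_egr h : dynkin_grading h = egr (ad h).
Proof. by []. Qed.

Lemma egrP T j x : reflect (T x = j%:~R *: x) (x \in egr T j).
Proof.
rewrite memv_ker add_lfunE opp_lfunE scale_lfunE id_lfunE subr_eq0; exact: eqP.
Qed.

Lemma egr_sum_stable T U (s : seq int) (x : int -> L) : uniq s ->
  {in s, forall j, x j \in egr T j} -> stable T U ->
  \sum_(j <- s) x j \in U -> {in s, forall j, x j \in U}.
Proof.
move=> us xE; apply: (@eigensum_stable _ _ T U _ (fun j : int => j%:~R)) => //.
  by move=> i j _ _ /eqP; rewrite eqr_int => /eqP.
by move=> j js; apply/egrP/xE.
Qed.

Lemma egr_indep T (s : seq int) (x : int -> L) : uniq s ->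
  {in s, forall j, x j \in egr T j} -> \sum_(j <- s) x j = 0 ->
  {in s, forall j, x j = 0}.
Proof.
move=> us xE x0 j js; apply/eqP; rewrite -memv0; move: j js.
by apply: (@egr_sum_stable T) => //; [exact: stable0 | rewrite x0 mem0v].
Qed.

(** The homogeneous components of a vector of a stable [U] stay in [U], so properties closed under
    sums can be tested on homogeneous vectors of [U]. *)
Lemma idiag_ind T U (Q : L -> Prop) : idiag T -> stable T U ->
  Q 0 -> (forall x y, Q x -> Q y -> Q (x + y)) ->
  (forall j x, x \in U -> x \in egr T j -> Q x) -> forall x, x \in U -> Q x.
Proof.
move=> dT sU Q0 QD QE x xU.
have [s [y [us yE xE]]] := in_gsum_decomp (dT x).
have yU : {in s, forall j, y j \in U}.
  by apply: (@egr_sum_stable T) => // [j js|]; [case: (yE j js) | rewrite -xE].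
rewrite xE big_seq; elim/big_ind: _ => // j js; apply: (QE j); first exact: yU.
by case: (yE j js).
Qed.

Lemma graded_stableP T U : idiag T ->
  graded_subspace (egr T) U <-> stable T U.
Proof.
move=> dT; split=> [[UE _] x /UE|sU].
  elim/in_gsum_ind => [|u v uU vU|j u _ /memv_capP[uU /egrP->]].
  - by rewrite linear0 mem0v.
  - by rewrite linearD memvD.
  - exact: memvZ.
split=> [x|s us].
  split; last by elim/in_gsum_ind => [|u v|j u _ /memv_capP[]//];
                 [exact: mem0v | exact: memvD].
  move: x; apply: (idiag_ind dT sU); first exact: in_gsum0.
    exact: in_gsumD.
  by move=> j x xU xj; apply: (@in_gsum_mem _ _ _ _ j) => //; rewrite memv_cap xU.
apply/directv_seqP => // x xE; apply: (@egr_indep T) => // j js.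
by have /memv_capP[] := xE j js.
Qed.

Lemma lie_egr T i j x y : derivation T -> x \in egr T i -> y \in egr T j ->
  lie x y \in egr T (i + j).
Proof.
move=> dT /egrP xi /egrP yj; apply/egrP.
by rewrite dT xi yj lieZl lieZr -scalerDl rmorphD.
Qed.

Lemma egr_grading T : derivation T -> idiag T -> is_grading (egr T).
Proof.
move=> dT iT; split; last by move=> i j x y; exact: lie_egr.
split=> [x|s us]; first by rewrite memvf; split.
by apply/directv_seqP => // x; exact: egr_indep.
Qed.

Lemma grading_derivation (G : int -> {vspace L}) : is_grading G ->
  exists T, [/\ derivation T, idiag T & G = egr T].
Proof.
case=> -[Gf Gd] Gl.
have Gi (s : seq int) : uniq s -> forall x : int -> L,
    {in s, forall i, x i \in G i} -> \sum_(i <- s) x i = 0 ->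
    {in s, forall i, x i = 0}.
  by move=> us; apply/directv_seqP => //; exact: Gd.
have Gf' x : in_gsum G predT x by apply/Gf; rewrite memvf.
have [s us sE] := in_gsum_support Gf'.
have [T TP] := scaled_lfun_exists (fun j : int => j%:~R) us (Gi s us) sE.
have GT j x : x \in G j -> T x = j%:~R *: x.
  move=> xj; have [js|js] := boolP (j \in s); first exact: TP.
  suff -> : x = 0 by rewrite linear0 scaler0.
  have : x \in (\sum_(j <- s) G j)%VS by rewrite sE memvf.
  case/(seq_sumv_decomp us) => y yG xE.
  have ujs : uniq (j :: s) by rewrite /= js.
  rewrite xE; apply: (@indep_notin_sum _ _ _ G s j y (Gi _ ujs)) => //.
    by move=> i i_s; apply: yG.
  by rewrite -xE.
exists T; split.
- move=> x y.
  elim/in_gsum_ind: (Gf' x) => [|u v hu hv|i {}x _ xi].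
  + by rewrite !(lie0l, linear0) addr0.
  + by rewrite !(lieDl, linearD) /= hu hv addrACA.
  elim/in_gsum_ind: (Gf' y) => [|u v hu hv|j {}y _ yj].
  + by rewrite !(lie0r, linear0) addr0.
  + by rewrite !linearD /= hu hv addrACA.
  rewrite (GT _ _ xi) (GT _ _ yj) lieZl lieZr -scalerDl -rmorphD /=.
  by apply/GT/Gl.
- move=> x; elim/in_gsum_ind: (Gf' x) => [|u v|j u _ uj].
  + exact: in_gsum0.
  + exact: in_gsumD.
  + by apply: (@in_gsum_mem _ _ _ _ j) => //; apply/egrP/GT.
apply/funext => j; apply/vspaceP => x; apply/idP/idP => [/GT/egrP//|/egrP xj].
have [t [y [ut yP xE]]] := in_gsum_decomp (Gf' x).
have y0 : {in t, forall i, (i%:~R - j%:~R) *: y i = 0}.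
  apply: Gi => // [i it|]; first by apply: memvZ; case: (yP i it).
  rewrite (eq_big_seq (fun i => T (y i) - j%:~R *: y i)); last first.
    by move=> i it; rewrite scalerBl (GT i) //; case: (yP i it).
  by rewrite sumrB -scaler_sumr -linear_sum /= -xE xj subrr.
rewrite xE big_seq; apply: memv_suml => i it.
have [<-|ij] := eqVneq i j; first by case: (yP i it).
have /eqP := y0 i it; rewrite scaler_eq0 subr_eq0 eqr_int (negPf ij) => /eqP->.
exact: mem0v.
Qed.

Lemma idiag_support T : idiag T -> exists s : seq int, uniq s /\
  (\sum_(j <- s) egr T j)%VS = fullv /\ forall j, j \notin s -> egr T j = 0%VS.
Proof.
move=> iT; have [s us sE] := in_gsum_support iT; exists s; split=> //; split=> // j js.
apply/eqP; rewrite -subv0; apply/subvP => x xj; rewrite memv0.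
have : x \in (\sum_(j <- s) egr T j)%VS by rewrite sE memvf.
case/(seq_sumv_decomp us) => y yG xE.
have ujs : uniq (j :: s) by rewrite /= js.
rewrite xE; apply/eqP.
apply: (@indep_notin_sum _ _ _ (egr T) s j y (fun z => @egr_indep T _ z ujs)) => //.
  by move=> i i_s; apply: yG.
by rewrite -xE.
Qed.

(** Finite support reduces the sum over a possibly infinite [P] to a finite one. [idiag T] stands
    under the existential so that the choice of [W] is total in [T]. *)
Lemma gpart_exists T P : exists W : {vspace L},
  idiag T -> forall x, x \in W <-> in_gsum (egr T) P x.
Proof.
have [iT|nT] := pselect (idiag T); last by exists 0%VS.
have [s [us [sE s0]]] := idiag_support iT.
exists (\sum_(j <- s | P j) egr T j)%VS => _ x; split; first by exists s.
elim/in_gsum_ind => [|u v|j u Pj uj].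
- exact: mem0v.
- exact: memvD.
have [js|/s0 j0] := boolP (j \in s); first exact: (subvP (seq_sumv_sup _ _ _)) uj.
by move: uj; rewrite j0 memv0 => /eqP->; exact: mem0v.
Qed.

(* Junk (the zero subspace) unless [idiag T]. *)
Definition gpart T P : {vspace L} := sval (cid (gpart_exists T P)).

Lemma gpartP T P x : idiag T -> x \in gpart T P <-> in_gsum (egr T) P x.
Proof. by move=> iT; apply: (svalP (cid (gpart_exists T P)) iT). Qed.

Lemma gpart_mem T P j x : idiag T -> x \in egr T j -> P j -> x \in gpart T P.
Proof. by move=> iT xj Pj; apply/gpartP => //; apply: in_gsum_mem Pj. Qed.

Lemma gpart_ind T P (Q : L -> Prop) : idiag T -> Q 0 ->
  (forall x y, Q x -> Q y -> Q (x + y)) ->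
  (forall j x, P j -> x \in egr T j -> Q x) -> forall x, x \in gpart T P -> Q x.
Proof. by move=> iT Q0 QD QE x /(gpartP _ _ iT); apply: in_gsum_ind. Qed.

Lemma gpart_sub T P U : idiag T -> (forall j, P j -> (egr T j <= U)%VS) ->
  (gpart T P <= U)%VS.
Proof.
move=> iT PU; apply/subvP; apply: gpart_ind => //; first exact: mem0v.
  by move=> x y; apply: memvD.
by move=> j x /PU/subvP; apply.
Qed.

Lemma gpartS T P P' : idiag T -> (forall j, P j -> P' j) ->
  (gpart T P <= gpart T P')%VS.
Proof.
move=> iT PP; apply: gpart_sub => // j /PP Pj; apply/subvP => x xj.
exact: gpart_mem Pj.
Qed.

Lemma stable_egr T f j : (forall x, f (T x) = T (f x)) -> stable f (egr T j).
Proof. by move=> fT x /egrP xj; apply/egrP; rewrite -fT xj linearZ. Qed.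

Lemma stable_gpart T f P : idiag T -> (forall x, f (T x) = T (f x)) ->
  stable f (gpart T P).
Proof.
move=> iT fT x; move: x; apply: gpart_ind => //; first by rewrite linear0 mem0v.
  by move=> x y fx fy; rewrite linearD memvD.
by move=> j x Pj xj; apply: gpart_mem Pj => //; apply: stable_egr.
Qed.

Lemma egr_gpart T P j x : idiag T -> x \in egr T j -> x \in gpart T P ->
  P j \/ x = 0.
Proof.
move=> iT xj /(gpartP _ _ iT)/in_gsum_decomp[s [y [us yP xE]]].
have [js|js] := boolP (j \in s); first by left; case: (yP j js).
right; have ujs : uniq (j :: s) by rewrite /= js.
rewrite xE.
apply: (@indep_notin_sum _ _ _ (egr T) s j y (fun z => @egr_indep T _ z ujs)) => //.
  by move=> i /yP[].
by rewrite -xE.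
Qed.

Lemma lie_gpart T (P Q R : pred int) x y : derivation T -> idiag T ->
  (forall i j, P i -> Q j -> R (i + j)) ->
  x \in gpart T P -> y \in gpart T Q -> lie x y \in gpart T R.
Proof.
move=> dT iT PQR xP yQ; move: x xP; apply: gpart_ind => //.
- by rewrite lie0l mem0v.
- by move=> u v hu hv; rewrite lieDl memvD.
move=> i x Pi xi; move: y yQ; apply: gpart_ind => //.
- by rewrite lie0r mem0v.
- by move=> u v hu hv; rewrite lieDr memvD.
move=> j y Qj yj; apply: (@gpart_mem _ _ (i + j)) => //; last exact: PQR.
exact: lie_egr.
Qed.

Lemma killing_egr T i j x y : derivation T -> x \in egr T i -> y \in egr T j ->
  i + j != 0 -> killing x y = 0.
Proof.
move=> dT /egrP xi /egrP yj ij; have := killing_der x y dT.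
rewrite xi yj killingZl killingZr => /eqP; rewrite -addr_eq0 -mulrDl -rmorphD /=.
by rewrite mulf_eq0 intr_eq0 (negPf ij) => /eqP.
Qed.

Lemma killing_gpart T (P Q : pred int) x y : derivation T -> idiag T ->
  (forall i j, P i -> Q j -> i + j != 0) ->
  x \in gpart T P -> y \in gpart T Q -> killing x y = 0.
Proof.
move=> dT iT PQ xP yQ; move: x xP; apply: gpart_ind => //.
- by rewrite killing0l.
- by move=> u v hu hv; rewrite killingDl hu hv addr0.
move=> i x Pi xi; move: y yQ; apply: gpart_ind => //.
- by rewrite killing0r.
- by move=> u v hu hv; rewrite killingDr hu hv addr0.
by move=> j y Qj yj; apply: (killing_egr dT xi yj); apply: PQ.
Qed.

Lemma idiag_proj T i : idiag T -> exists p : 'End(L),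
  (forall j x, x \in egr T j -> p x = if j == i then x else 0) /\
  (forall U, stable T U -> stable p U).
Proof.
move=> iT; have [s [us [sE s0]]] := idiag_support iT.
have [p pP] := scaled_lfun_exists (fun j : int => (j == i)%:R) us
  (fun z => @egr_indep T s z us) sE.
have pE j x : x \in egr T j -> p x = if j == i then x else 0.
  move=> xj; have [js|/s0 j0] := boolP (j \in s).
    by rewrite (pP j) //; case: eqP; rewrite ?scale1r ?scale0r.
  by move: xj; rewrite j0 memv0 => /eqP->; rewrite linear0; case: eqP.
exists p; split=> // U sU x xU.
apply: (idiag_ind iT sU (Q := fun x => p x \in U)) xU.
- by rewrite linear0 mem0v.
- by move=> u v pu pv; rewrite linearD memvD.
by move=> j u uU uj; rewrite (pE j) //; case: eqP => // _; exact: mem0v.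
Qed.

Lemma egr_add_split T i A B x : idiag T -> stable T A -> stable T B ->
  x \in egr T i -> x \in (A + B)%VS ->
  exists u v, [/\ u \in A, v \in B, u \in egr T i, v \in egr T i & x = u + v].
Proof.
move=> iT sA sB xi /memv_addP[u uA [v vB xE]].
have [p [pE ps]] := idiag_proj i iT.
have pi y : p y \in egr T i.
  apply: (idiag_ind iT (@stablef _ _ T) (Q := fun y => p y \in egr T i)) (memvf y).
  - by rewrite linear0 mem0v.
  - by move=> a b pa pb; rewrite linearD memvD.
  by move=> j a _ aj; rewrite (pE j) //; case: eqP => [<-|_]; rewrite ?mem0v.
exists (p u), (p v); split; rewrite ?pi //; [exact: ps | exact: ps |].
by rewrite -linearD /= -xE (pE i) ?eqxx.
Qed.

End DiagonalDerivations.

Global Opaque egr gpart.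

(** * The theorems of Jacobson and Morozov *)

Section KleineckeShirokov.
Variables (R : pzRingType) (e z c : R).
Hypotheses (cE : c = e * z - z * e) (ec : e * c = c * e).

Let d (x : R) := e * x - x * e.

Let dM x y : d (x * y) = d x * y + x * d y.
Proof. by rewrite /d mulrBl mulrBr !mulrA addrA subrK. Qed.

Let dD x y : d (x + y) = d x + d y.
Proof. by rewrite /d mulrDl mulrDr opprD addrACA. Qed.

Let dMn x n : d (x *+ n) = d x *+ n.
Proof. by rewrite /d mulrnAl mulrnAr mulrnBl. Qed.

Let d_iter_mul m x :
  iter m.+1 d (x * z) = iter m.+1 d x * z + (iter m d x * c) *+ m.+1.
Proof.
have dc : d c = 0 by rewrite /d ec subrr.
elim: m => [|m IHm]; first by rewrite /= dM mulr1n cE.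
rewrite iterS IHm dD dM dMn dM dc mulr0 addr0 -/(d z).
have -> : d z = c by rewrite cE.
by rewrite [in RHS]mulrS addrA.
Qed.

Let d_iter_exp n : iter n.+1 d (z ^+ n) = 0 /\ iter n d (z ^+ n) = c ^+ n *+ n`!.
Proof.
elim: n => [|n [IH0 IH1]]; first by rewrite /= /d mulr1 mul1r subrr.
rewrite exprSr; split.
  rewrite d_iter_mul IH0 mul0r mul0rn addr0.
  by rewrite iterS IH0 /d mulr0 mul0r subrr mul0r.
by rewrite d_iter_mul IH0 mul0r add0r IH1 mulrnAl -exprSr -mulrnA factS mulnC.
Qed.

(** For the derivation [d = [e, -]] one has [d z = c] and [d c = 0], whence [d^m (z^m) = m! c^m].
    But [d^(2n) = 0], because each term of its expansion has a factor [e^n] on the left or on the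
    right. *)
Lemma commutator_nilpotent n : e ^+ n = 0 -> c ^+ (n + n) *+ (n + n)`! = 0.
Proof.
move=> en; have [_ <-] := d_iter_exp (n + n).
suff main m i j x : (n + n <= i + j + m)%N -> e ^+ i * iter m d x * e ^+ j = 0.
  by have := main (n + n)%N 0%N 0%N (z ^+ (n + n)) (leqnn _); rewrite !expr0 mul1r mulr1.
elim: m i j => [|m IHm] i j le.
  have [ni|ni] := leqP n i.
    by rewrite -(subnK ni) exprD en mulr0 !mul0r.
  have nj : (n <= j)%N by lia.
  by rewrite -(subnKC nj) exprD en mul0r mulr0.
rewrite iterS; set y := iter m d x.
have -> : e ^+ i * d y * e ^+ j = e ^+ i.+1 * y * e ^+ j - e ^+ i * y * e ^+ j.+1.
  by rewrite /d mulrBr mulrBl exprSr exprS !mulrA.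
by rewrite !IHm ?subrr //; lia.
Qed.

End KleineckeShirokov.

Section TraceCommutator.
Variables (K : numClosedFieldType) (L : lieAlgType K) (E Z C : 'End(L)).
Hypotheses (CE : C = (E \o Z)%VF - (Z \o E)%VF) (EC : (E \o C = C \o E)%VF).
Variable (N : nat).
Hypothesis (EN : forall v, iter N E v = 0).

Lemma commutator_eigenvalue0 a u : u != 0 -> C u = a *: u -> a = 0.
Proof.
move=> u0 uE; pose B := vbasis {:L}.
have BP : basis_of {:L} B := vbasisP _.
pose m := passmx.mxof B B.
have mD f g : m (f - g) = m f - m g.
  have := passmx.mxof_linear B B (-1) g f.
  by rewrite !scaleN1r ![- _ + _]addrC.
have mM f g : m (f \o g)%VF = m g * m f by rewrite /m (passmx.mxof_comp _ _ BP).
have iterM (f : 'End(L)) n v : passmx.rVof B (iter n f v) = passmx.rVof B v *m (m f ^+ n).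
  elim: n => [|n IHn]; first by rewrite expr0 mulmx1.
  by rewrite iterS (passmx.rVof_app _ BP) IHn -mulmxA exprSr.
have mEN : m E ^+ N = 0.
  apply/row_matrixP => i; rewrite row0 rowE -(passmx.vecofK BP (delta_mx 0 i)).
  by rewrite -iterM EN; apply/eqP; rewrite passmx.rVof_eq0.
(* Matrices act on row vectors, so [m] reverses products and the commutator changes sign. *)
have mC : - m C = m E * m Z - m Z * m E by rewrite CE mD !mM opprB.
have mEC : m E * (- m C) = (- m C) * m E by rewrite mulrN mulNr -!mM EC.
have /eqP := commutator_nilpotent mC mEC mEN.
rewrite -scaler_nat scaler_eq0 pnatr_eq0 gtn_eqF ?fact_gt0 //= => /eqP.
set n := (N + N)%N; rewrite exprNn => /(congr1 (mulmx (passmx.rVof B u))).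
rewrite mulmx0 -signr_odd mulr_sign => h.
have {h} : passmx.rVof B (iter n C u) = 0.
  by rewrite iterM; move: h; case: odd => //; rewrite mulmxN => /eqP; rewrite oppr_eq0 => /eqP.
have -> : iter n C u = a ^+ n *: u.
  elim: n => [|n IHn]; first by rewrite expr0 scale1r.
  by rewrite iterS IHn linearZ /= uE scalerA exprSr.
move/eqP; rewrite passmx.rVof_eq0 // scaler_eq0 (negPf u0) orbF expf_eq0.
by case/andP => _ /eqP.
Qed.

(** If [E Z v = r v] and [E^k v] is the last nonzero iterate of [v], commuting [Z] past [E^(k+1)]
    makes [E^k v] an eigenvector of [C] with eigenvalue [r / (k + 1)], so [r = 0]: all eigenvalues
    of [E Z] vanish. *)
Lemma trace_commutator0 : lfun_trace (E \o Z) = 0.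
Proof.
apply: lfun_trace_nilpotent => r v v0; rewrite comp_lfunE => vE.
have CEv w : E (Z w) = Z (E w) + C w.
  by rewrite CE add_lfunE opp_lfunE !comp_lfunE addrC subrK.
have ECv w : E (C w) = C (E w) by rewrite -!comp_lfunE EC.
have iterC k : iter k.+1 E (Z v) = Z (iter k.+1 E v) + k.+1%:R *: C (iter k E v).
  elim: k => [|k IHk]; first by rewrite scale1r /= CEv.
  rewrite iterS IHk linearD linearZ /= CEv ECv -addrA; congr (_ + _).
  by rewrite -[k.+2%:R]natr1 scalerDl scale1r addrC.
have ex0 : exists n, iter n E v == 0 by exists N; rewrite EN.
case: (@ex_minnP (fun n => iter n E v == 0) ex0) => -[|k] kP kmin.
  by rewrite /= (negPf v0) in kP.
have w0 : iter k E v != 0 by apply/negP => /kmin; rewrite ltnn.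
have k0 : k.+1%:R != 0 :> K by rewrite pnatr_eq0.
have Cw : C (iter k E v) = (r / k.+1%:R) *: iter k E v.
  apply: (scalerI k0); rewrite scalerA mulrC divfK //.
  have := iterC k; rewrite (eqP kP) linear0 add0r => <-.
  rewrite iterSr vE; elim: k {iterC kP kmin w0 k0} => //= k ->; exact: linearZ.
have := commutator_eigenvalue0 w0 Cw.
by move/eqP; rewrite mulf_eq0 invr_eq0 (negPf k0) orbF => /eqP.
Qed.

End TraceCommutator.

(** * Homogeneous sl2-triples *)

Section JacobsonMorozov.
Variables (K : numClosedFieldType) (L : lieAlgType K).
Hypothesis nd : killing_nondeg L.
Implicit Types (e h f x y : L) (T : 'End(L)).

(** [(ad e)^2] is self-adjoint for the Killing form, so a [z] orthogonal to its image satisfies [[e,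
    [e, z]] = 0]; then [killing e z] is the trace of [ad e \o ad z] with [ad e] commuting with [ad
    [e, z]], and vanishes. *)
Lemma nilpotent_in_square e : lie_nilpotent e -> exists y, e = lie e (lie e y).
Proof.
case=> N eN; pose U := limg (ad e \o ad e)%VF.
suff : e \in U by case/memv_imgP => y _; rewrite comp_lfunE !adE => yE; exists y.
rewrite -(kperpK U nd); apply/kperpP => z /kperpP zU.
have ez0 : lie e (lie e z) = 0.
  apply: nd => y; rewrite !killing_lie opprK killingC killingC zU //.
  by apply/memv_imgP; exists y; rewrite ?memvf // comp_lfunE !adE.
rewrite killingE; apply: (@trace_commutator0 _ _ (ad e) (ad z) (ad (lie e z)) _ _ N eN).
  exact: ad_lie.
by apply/eqP; rewrite -subr_eq0 -ad_lie ez0 -(scale0r 0) adZ scale0r.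
Qed.

(** Degrees are doubled because [- a / 2] need not be an integer. *)
Definition half_optimal T (a : int) e : Prop :=
  forall x, x \in gpart T (fun j => j *+ 2 < - a) -> lie e x = 0 -> x = 0.

(** The component of degree [- a] of a solution of [e = [e, [e, y]]] gives homogeneous [f] and [h].
    The relation for [[h, f]], which in general requires correcting [f], is automatic: [[h, f] + 2
    f] commutes with [e] and has degree [- a < - a / 2]. *)
Lemma graded_sl2_triple T (a : int) e : derivation T -> idiag T -> 0 < a ->
  e \in egr T a -> lie_nilpotent e -> half_optimal T a e ->
  exists h f, [/\ sl2_triple e h f, h \in egr T 0 & f \in egr T (- a)].
Proof.
move=> dT iT a0 ea en ho.
have [p pP] := choice (fun i => idiag_proj i iT).
have pE i j x : x \in egr T j -> p i x = if j == i then x else 0.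
  by case: (pP i) => h _; apply: h.
have pin i x : p i x \in egr T i.
  apply: (idiag_ind iT (@stablef _ _ T) (Q := fun y => p i y \in egr T i)) (memvf x).
  - by rewrite linear0 mem0v.
  - by move=> u v pu pv; rewrite linearD memvD.
  move=> j u _ uj; rewrite (pE i j u uj); case: eqP => [<-|_]; first exact: uj.
  exact: mem0v.
have pe i x : p (a + i) (lie e x) = lie e (p i x).
  apply: (idiag_ind iT (@stablef _ _ T)
    (Q := fun x => p (a + i) (lie e x) = lie e (p i x))) (memvf x).
  - by rewrite !(lie0r, linear0).
  - by move=> u v hu hv; rewrite !linearD /= hu hv.
  move=> j u _ uj; rewrite (pE i j) // (pE _ (a + j)) ?(inj_eq (addrI a)).
    by case: eqP => // _; rewrite lie0r.
  exact: lie_egr ea uj.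
have [y yE] := nilpotent_in_square en.
have e2 : e = lie e (lie e (p (- a) y)).
  rewrite -pe subrr -[0]addr0 -{1}[0]addr0 !addr0.
  by rewrite -pe addr0 -yE (pE a a) ?eqxx.
(* The factor [- 2] is forced by [[h, e] = - [e, [e, f]] = 2 e]. *)
pose f := (- 2%:R) *: p (- a) y; pose h := lie e f.
have fa : f \in egr T (- a) by apply/memvZ/pin.
have h0 : h \in egr T 0 by have := lie_egr dT ea fa; rewrite subrr.
have he : lie h e = e *+ 2.
  by rewrite lieC /h /f !lieZr -e2 scaleNr opprK scaler_nat.
have hE : lie e f = h by [].
exists h, f; move: f h fa h0 he hE => f h fa h0 he hE; split; [split=> //|exact: h0|exact: fa].
apply/eqP; rewrite -addr_eq0; apply/eqP; apply: ho.
  have zin : lie h f + f *+ 2 \in egr T (- a).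
    apply: memvD; last by rewrite -scaler_nat; apply: memvZ fa.
    by have := lie_egr dT h0 fa; rewrite add0r.
  by apply: (gpart_mem iT zin); rewrite mulr2n gtrDl oppr_lt0.
rewrite lieDr lie_leibniz hE liexx addr0 -[f *+ 2]scaler_nat lieZr hE.
by rewrite (lieC e h) he lieNl -scaler_nat lieZl hE addNr.
Qed.

End JacobsonMorozov.

(** * Diagonalizability of [ad h] for an sl2-triple with nilpotent [e] *)

Section Sl2.
Variables (K : numClosedFieldType) (L : lieAlgType K) (e h f : L).
Hypotheses (tr : sl2_triple e h f) (en : lie_nilpotent e).
Implicit Types (v w x y u : L).

Let he : lie h e = e *+ 2. Proof. by case: tr. Qed.
Let ef : lie e f = h. Proof. by case: tr. Qed.
Let hf : lie h f = - (f *+ 2). Proof. by case: tr. Qed.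
Let Ein x := in_gsum (egr (ad h)) predT x.

Let h_e v : lie h (lie e v) = lie e (lie h v) + 2%:R *: lie e v.
Proof. by rewrite lie_leibniz he -scaler_nat lieZl addrC. Qed.

Let h_iter k v : lie h (iter k (ad e) v) =
  iter k (ad e) (lie h v) + (k + k)%:R *: iter k (ad e) v.
Proof.
elim: k => [|k IHk]; first by rewrite scale0r addr0.
rewrite !iterS !adE h_e IHk lieDr lieZr -addrA -scalerDl -natrD.
by congr (_ + _%:R *: _); lia.
Qed.

Let e_iter_f k w : iter k.+1 (ad e) (lie f w) =
  lie f (iter k.+1 (ad e) w) +
  k.+1%:R *: iter k (ad e) (lie h w + k%:R *: w).
Proof.
elim: k => [|k IHk].
  by rewrite /= !adE lie_leibniz ef scale0r addr0 scale1r addrC.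
rewrite iterS IHk adE lieDr lieZr lie_leibniz ef -!(adE e) -!iterS h_iter.
rewrite !linearD !linearZ /= -!iterS.
set A := iter k.+1 (ad e) (lie h w); set B := iter k.+1 (ad e) w.
set F := lie f _.
transitivity (F + ((1 + k.+1%:R) *: A + ((k.+1 + k.+1)%:R + k.+1%:R * k%:R) *: B)).
  rewrite !scalerDl scale1r scalerA.
  by rewrite addrAC [A + _ + _]addrACA addrC (mulrC k%:R).
congr (F + _); rewrite scalerA -nat1r.
by congr (_ *: A + _ *: B); ring.
Qed.

(** Let [k] be maximal with [v = e^k w]. Then [e^(k+1) f w = (k + 1) (a - k) v], so [a != k] would
    put [v] in the image of [e^(k+1)]. *)
Lemma sl2_kernel_eigenvalue v a : lie e v = 0 -> lie h v = a *: v -> v != 0 ->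
  exists k : nat, a = k%:R.
Proof.
move=> ev hv v0; case: en => N eN.
pose P k := v \in limg (linfun (iter k (ad e))).
have PP k : reflect (exists w, v = iter k (ad e) w) (P k).
  apply: (iffP memv_imgP) => [[w _ ->]|[w ->]]; exists w; rewrite ?memvf ?lfunE //.
have exP : exists k, P k by exists 0%N; apply/PP; exists v.
have ubP k : P k -> (k <= N)%N.
  case/PP => w vE; rewrite leqNgt; apply: contra v0 => lt.
  by rewrite vE -(subnK (ltnW lt)) iterD eN linear0.
case: (ex_maxnP exP ubP) => k /PP[w vE] kmax; exists k.
apply/eqP; rewrite -subr_eq0; apply: contraT => ak.
have : P k.+1.
  apply/PP; exists ((k.+1%:R * (a - k%:R))^-1 *: lie f w).
  rewrite linearZ /= -!iterS e_iter_f iterS -vE adE ev lie0r add0r.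
  have -> : iter k (ad e) (lie h w + k%:R *: w) = (a - k%:R) *: v.
    have hw : iter k (ad e) (lie h w) = a *: v - (k + k)%:R *: v.
      by rewrite -hv vE h_iter addrK.
    rewrite linearD linearZ /= hw -vE -scalerBl -scalerDl.
    by congr (_ *: v); ring.
  by rewrite !scalerA -mulrA mulVf ?scale1r // mulf_neq0 // pnatr_eq0.
by move/kmax; rewrite ltnn.
Qed.

Let Ein0 : Ein 0. Proof. exact: in_gsum0. Qed.
Let EinD x y : Ein x -> Ein y -> Ein (x + y). Proof. exact: in_gsumD. Qed.

Let EinZ a x : Ein x -> Ein (a *: x).
Proof.
elim/in_gsum_ind => [|u v|j u _ uj]; first by rewrite scaler0.
  by rewrite scalerDr; apply: EinD.
exact: in_gsum_mem (memvZ a uj) isT.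
Qed.

Let Ein_ad y i : y \in egr (ad h) i -> forall x, Ein x -> Ein (lie y x).
Proof.
move=> yi x; elim/in_gsum_ind => [|u v hu hv|j u _ uj].
- by rewrite lie0r.
- by rewrite lieDr; apply: EinD.
exact: in_gsum_mem (lie_egr (ad_derivation h) yi uj) isT.
Qed.

Let e2 : e \in egr (ad h) 2.
Proof. by apply/egrP; rewrite adE he -scaler_nat. Qed.

Let f2 : f \in egr (ad h) (- 2).
Proof. by apply/egrP; rewrite adE hf -scaler_nat rmorphN scaleNr. Qed.

(** Descending induction on [k] for [w] in the kernel of [e] and the image of [e^k]: [(h - k) w]
    lies in the image of [e^(k+1)], so it is a sum of eigenvectors with eigenvalues above [k]. There
    [h - k] is invertible, and what remains of [w] is an eigenvector for [k]. *)
Let kernel_diag v : lie e v = 0 -> Ein v.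
Proof.
case: en => N eN.
suff main m k w : (k + m = N)%N -> lie e w = 0 ->
    (exists u, w = iter k (ad e) u) ->
    in_gsum (egr (ad h)) (fun j => k%:Z <= j) w.
  move=> ev; have := main N 0%N v (add0n _) ev (ex_intro _ v erefl).
  elim/in_gsum_ind => //= j u _ uj; exact: in_gsum_mem uj _.
elim: m k w => [|m IHm] k w.
  rewrite addn0 => -> _ [u ->]; rewrite eN; exact: in_gsum0.
rewrite addnS -addSn => km ew [u wE].
have [z zP zE] : exists2 z, in_gsum (egr (ad h)) (fun j => k.+1%:Z <= j) z &
    lie h z - k%:R *: z = lie h w - k%:R *: w.
  have : in_gsum (egr (ad h)) (fun j => k.+1%:Z <= j) (lie h w - k%:R *: w).
    apply: IHm => //.
      by have := h_e w; rewrite lieBr lieZr ew lie0r !scaler0 addr0 subr0 => <-.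
    exists (k.+1%:R^-1 *: lie f u); rewrite [RHS]linearZ /= -!iterS e_iter_f.
    rewrite iterS -wE adE ew lie0r add0r scalerA mulVf ?pnatr_eq0 // scale1r.
    have hu : iter k (ad e) (lie h u) = lie h w - (k + k)%:R *: w.
      by rewrite wE h_iter addrK.
    rewrite [RHS]linearD [X in _ = _ + X]linearZ /= hu -wE -addrA; congr (_ + _).
    by rewrite natrD scalerDl opprD addrNK.
  elim/in_gsum_ind => [|x y [x' x1 x2] [y' y1 y2]|j x kj xj].
  - by exists 0; [exact: in_gsum0 | rewrite lie0r scaler0 subr0].
  - exists (x' + y'); first exact: in_gsumD.
    by rewrite lieDr scalerDr opprD addrACA x2 y2.
  have jk0 : j%:~R - k%:R != 0 :> K by rewrite -[k%:R]/(k%:Z%:~R) -rmorphB intr_eq0; lia.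
  exists ((j%:~R - k%:R)^-1 *: x).
    exact: in_gsum_mem (memvZ _ xj) kj.
  have /egrP := xj; rewrite adE => xE.
  by rewrite lieZr xE [k%:R *: _]scalerA mulrC -scalerA -scalerBr -scalerBl scalerA mulVf // scale1r.
rewrite -(subrK z w); apply: in_gsumD.
  apply: (in_gsum_mem (j := k)); last exact: lexx.
  apply/egrP; rewrite adE lieBr scalerBr; apply/eqP.
  rewrite -[k%:Z%:~R]/(k%:R) subr_eq addrAC -subr_eq opprK addrC -subr_eq.
  by rewrite addrAC -zE subrK.
elim/in_gsum_ind: zP => [|x y|j x kj xj]; first exact: in_gsum0.
  exact: in_gsumD.
by apply: (in_gsum_mem xj); lia.
Qed.

Let Ein_resolvent (c : int) u : Ein u ->
  exists2 u', Ein u' & u - (lie h u' - c%:~R *: u') \in egr (ad h) c.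
Proof.
elim/in_gsum_ind => [|x y [x' x1 x2] [y' y1 y2]|j x _ xj].
- by exists 0; [exact: Ein0 | rewrite lie0r scaler0 !subr0 mem0v].
- exists (x' + y'); first exact: EinD.
  rewrite lieDr scalerDr (opprD (_ *: x')) [lie h x' + _ + _]addrACA opprD addrACA.
  exact: memvD.
have [->|jc] := eqVneq c j.
  by exists 0; [exact: Ein0 | rewrite lie0r scaler0 !subr0].
have jc0 : j%:~R - c%:~R != 0 :> K by rewrite -rmorphB intr_eq0 subr_eq0 eq_sym.
have /egrP := xj; rewrite adE => xE.
exists ((j%:~R - c%:~R)^-1 *: x); first exact: EinZ (in_gsum_mem xj isT).
rewrite lieZr xE !scalerA (mulrC c%:~R) -scalerBl -mulrBr (mulVf jc0) scale1r subrr.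
exact: mem0v.
Qed.

(** On a span of eigenvectors [h - c] and its square have the same kernel: no Jordan blocks. *)
Let Ein_semisimple (c : int) y : Ein y -> lie h y - c%:~R *: y \in egr (ad h) c ->
  lie h y - c%:~R *: y = 0.
Proof.
case/in_gsum_decomp => s [z [us zP yE]].
have zE j : j \in s -> lie h (z j) = j%:~R *: z j.
  by move=> /zP[_ /egrP]; rewrite adE.
have sumE : lie h y - c%:~R *: y = \sum_(j <- s) (j%:~R - c%:~R) *: z j.
  rewrite yE linear_sum scaler_sumr -sumrB; apply: eq_big_seq => j js.
  by rewrite /= zE // scalerBl.
rewrite sumE => /egrP; rewrite adE linear_sum scaler_sumr /= => /eqP.
rewrite -subr_eq0 -sumrB => /eqP sum0.
have z0 : {in s, forall j, lie h ((j%:~R - c%:~R) *: z j) -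
    c%:~R *: ((j%:~R - c%:~R) *: z j) = 0}.
  apply: (@egr_indep _ _ (ad h) s _ us _ sum0) => j js.
  have zj : z j \in egr (ad h) j by case: (zP j js).
  rewrite lieZr (zE _ js); exact: memvB (memvZ _ (memvZ _ zj)) (memvZ _ (memvZ _ zj)).
rewrite big_seq big1 // => j js; have := z0 j js.
rewrite lieZr zE // !scalerA mulrC -scalerBl -mulrBl => /eqP.
by rewrite scaler_eq0 mulf_eq0 orbb -scaler_eq0 => /eqP.
Qed.

(* If [e] kills [v] modulo the span of the eigenvectors of [h], then
   [h v = - (q + 1) v] modulo that span, whereas the eigenvalues of [h] on the
   kernel of [e] are nonnegative. *)
Lemma sl2_idiag : idiag (ad h).
Proof.
case: en => N eN.
suff main q v : iter q.+1 (ad e) v = 0 -> Ein v.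
  by move=> v; apply: (main N); rewrite iterS eN linear0.
elim: q v => [|q IHq]; first by move=> v; rewrite /= adE; apply: kernel_diag.
move: q.+1 (ltn0Sn q) IHq => {}q q0 IHq v ev.
have Eev : Ein (lie e v) by apply: IHq; rewrite -adE -iterSr.
(* Moving [f] across [iter q.+1 (ad e)], which kills [v], shows that [iter q (ad e)] kills this
   vector. *)
have /IHq : iter q (ad e) (lie e (lie f v) - q.+1%:R *: (lie h v + q%:R *: v)) = 0.
  rewrite linearB [X in _ - X]linearZ /= -[lie e (lie f v)]adE -iterSr e_iter_f ev lie0r add0r subrr //.
rewrite lie_leibniz ef => E1.
have := EinD E1 (EinZ (-1) (Ein_ad f2 Eev)).
have -> : lie h v + lie f (lie e v) - q.+1%:R *: (lie h v + q%:R *: v) +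
    -1 *: lie f (lie e v) = (- q%:R) *: (lie h v - (- q.+1%:Z)%:~R *: v).
  rewrite scaleN1r addrAC addrK rmorphN /= [- _ *: v]scaleNr opprK -pmulrn.
  transitivity ((1 - q.+1%:R) *: lie h v - (q.+1%:R * q%:R) *: v).
    by rewrite scalerBl scale1r scalerDr scalerA opprD addrA.
  rewrite scalerDr scalerA -scaleNr -nat1r.
  by congr (_ *: _ + _ *: _); ring.
move/(EinZ (- q%:R)^-1); rewrite scalerA mulVf ?oppr_eq0 ?pnatr_eq0 -?lt0n // scale1r => E2.
set c := - q.+1%:Z in E2.
(* Correcting [v] by a vector of the span pushes the defect [t = (h - c) v'] into the eigenspace of
   [c]. Then [[e, t] = 0] for want of Jordan blocks, and [t = 0] since [c] is negative. *)
have [u' Eu' tc] := Ein_resolvent c E2.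
have [v' v'E] : exists v', v' = v - u' by exists (v - u').
pose t := lie h v' - c%:~R *: v'.
have tE : lie h v - c%:~R *: v - (lie h u' - c%:~R *: u') = t.
  by rewrite /t v'E lieBr scalerBr !opprD !opprK addrACA.
rewrite tE in tc.
have et : lie h (lie e v') - (c + 2)%:~R *: lie e v' = lie e t.
  rewrite /t lieBr lieZr h_e (_ : (c + 2)%:~R = c%:~R + 2%:R); last by rewrite rmorphD.
  by rewrite (scalerDl _ c%:~R) opprD [- _ - _]addrC addrA addrK.
have Eev' : Ein (lie e v').
  by rewrite v'E lieBr -scaleN1r; apply: EinD => //; apply/EinZ/(Ein_ad e2).
have et0 : lie e t = 0.
  rewrite -et; apply: (Ein_semisimple Eev').
  rewrite et addrC; exact: lie_egr (ad_derivation h) e2 tc.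
have t0 : t = 0.
  apply/eqP; apply: contraT => t0; have /egrP := tc; rewrite adE => ht.
  by have [k] := sl2_kernel_eigenvalue et0 ht t0; rewrite -[k%:R]/(k%:Z%:~R) => /eqP; rewrite eqr_int.
rewrite -(subrK u' v) -v'E; apply: EinD => //.
have v'c : v' \in egr (ad h) c.
  by apply/egrP; rewrite adE; apply/eqP; rewrite -subr_eq0 -/t t0.
exact: in_gsum_mem v'c isT.
Qed.

Lemma sl2_kernel_ge0 j v : lie e v = 0 -> v \in egr (ad h) j -> v != 0 -> 0 <= j.
Proof.
move=> ev /egrP; rewrite adE => hv v0.
have [k] := sl2_kernel_eigenvalue ev hv v0.
by rewrite -[k%:R]/(k%:Z%:~R) => /eqP; rewrite eqr_int => /eqP->.
Qed.

Lemma sl2_e_egr : e \in egr (ad h) 2. Proof. exact: e2. Qed.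

Lemma sl2_half_optimal : half_optimal (ad h) 2 e.
Proof.
have ih := sl2_idiag.
move=> x xP ex.
have stk : stable (ad h) (gpart (ad h) (fun j => j *+ 2 < - 2%:Z) :&: centralizer e).
  apply: stableI; first exact: stable_gpart.
  move=> y; rewrite !memv_ker !adE => /eqP ey.
  by have := h_e y; rewrite ey lie0r scaler0 addr0 => <-.
apply: (idiag_ind ih stk (Q := fun x => x = 0)) => //.
- by move=> u v -> ->; rewrite addr0.
- move=> j u /memv_capP[uP]; rewrite memv_ker adE => /eqP eu uj.
  have [//|u0] := eqVneq u 0.
  have j0 := sl2_kernel_ge0 eu uj u0.
  by case: (egr_gpart ih uj uP) => //; lia.
by rewrite memv_cap xP memv_ker adE ex eqxx.
Qed.

End Sl2.

(** * Admissible pairs relative to a fixed grading *)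

Section Equivalence.
Variables (K : fieldType) (L : lieAlgType K) (e : L).
Implicit Types p q r : {vspace L} * {vspace L}.

Lemma comparable_pairs_sym p q : comparable_pairs e p q -> comparable_pairs e q p.
Proof. by case=> G [Gg [Gp [Gq [h|h]]]]; exists G; do ! split=> //; [right|left]. Qed.

Lemma equivalent_pairs_refl p : admissible e p -> equivalent_pairs e p p.
Proof. by move=> ap; exists 0%N, (fun=> p); split. Qed.

Lemma comparable_equivalent p q : comparable_pairs e p q -> equivalent_pairs e p q.
Proof.
move=> pq; exists 1%N, (fun i => if i is 0 then p else q).
case: (pq) => G [Gg [Gp [Gq _]]]; split=> //; last by case.
by case=> [|i] _; exists G.
Qed.

Lemma equivalent_pairs_trans q p r :
  equivalent_pairs e p q -> equivalent_pairs e q r -> equivalent_pairs e p r.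
Proof.
case=> k [c [c0 ck ca cc]] [l [d [d0 dl da dc]]].
exists (k + l)%N, (fun i => if (i <= k)%N then c i else d (i - k)%N); split=> //.
- case: leqP => [|_]; last by rewrite addKn.
  by rewrite -{2}[k]addn0 leq_add2l leqn0 => /eqP l0; rewrite l0 addn0 ck -d0 -dl l0.
- move=> i ikl; case: leqP => ik; first exact: ca.
  by apply: da; rewrite leq_subLR.
move=> i ikl; case: (ltngtP i k) => ik.
- exact: cc.
- by rewrite subSn ?(ltnW ik) //; apply: dc; rewrite ltn_subLR ?(ltnW ik).
rewrite ik ck -d0 subSnn; apply: dc.
by move: ikl; rewrite ik -{1}[k]addn0 ltn_add2l.
Qed.

Lemma equivalent_pairs_sym p q : equivalent_pairs e p q -> equivalent_pairs e q p.
Proof.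
case=> k [c [c0 ck ca cc]]; exists k, (fun i => c (k - i)%N); split.
- by rewrite subn0.
- by rewrite subnn.
- by move=> i _; apply: ca; rewrite leq_subr.
move=> i ik; apply: comparable_pairs_sym; rewrite -(subnSK ik); apply: cc.
by rewrite subnSK // leq_subr.
Qed.

End Equivalence.

Section AdmissiblePairs.
Variables (K : numClosedFieldType) (L : lieAlgType K).
Hypothesis nd : killing_nondeg L.
Variable (e : L).
Implicit Types (T : 'End(L)) (a : int) (m n U W : {vspace L}) (x y u : L).

Lemma centralizerP x : reflect (lie e x = 0) (x \in centralizer e).
Proof. by rewrite memv_ker adE; apply: eqP. Qed.

Lemma stable_centralizer T a : derivation T -> e \in egr T a ->
  stable T (centralizer e).
Proof.
move=> dT /egrP ea x /centralizerP ex; apply/centralizerP.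
by have := dT e x; rewrite ex linear0 ea lieZl ex scaler0 add0r.
Qed.

(* Admissibility relative to the eigenspace grading of [T], with (A3) rewritten
   by means of the form [killing (lie e y) u] and without (A6), which follows. *)
Record adm_data T a m n : Prop := AdmData {
  adm_stable_m : stable T m;
  adm_stable_n : stable T n;
  adm_low : (gpart T (fun j => j <= - a)%R <= m)%VS;
  adm_sub : (m <= n)%VS;
  adm_neg : (n <= gpart T (fun j => j < 0)%R)%VS;
  adm_orth : forall y u, y \in n -> u \in m -> killing (lie e y) u = 0;
  adm_orth_sub : forall y, (forall u, u \in m -> killing (lie e y) u = 0) ->
    y \in (n + centralizer e)%VS;
  adm_inj : forall x, x \in n -> lie e x = 0 -> x = 0;
  adm_nm : forall x y, x \in n -> y \in m -> lie x y \in m;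
  adm_nn : forall x y, x \in n -> y \in n -> lie x y \in n
}.

(** [[L, e]] is the orthogonal of the centralizer, so (A3) identifies [[n, e]] with the orthogonal
    of [m + centralizer e]. As [ad e] is injective on [n] and on [m], counting dimensions gives
    (A6). *)
Lemma adm_data_rel T a m n : derivation T -> idiag T -> 1 < a -> e \in egr T a ->
  adm_data T a m n -> admissible_rel e (egr T) (m, n).
Proof.
move=> dT iT a1 ea [sm sn low mn neg orth orth_sub inj nm nn].
have ncap : (n :&: centralizer e = 0)%VS.
  apply/eqP; rewrite -subv0; apply/subvP => x /memv_capP[xn /centralizerP ex].
  by rewrite memv0 (inj x).
have A3 x : killing_orth m x /\ x \in lie_img fullv e <-> x \in lie_img n e.
  split=> [[xm /memv_imgP[y _ xE]]|/memv_imgP[y yn ->]].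
    rewrite adE in xE; rewrite xE in xm *.
    have /memv_addP[u un [z /centralizerP ez ->]] := orth_sub y xm.
    by rewrite lieDr ez addr0 -adE memv_img.
  split; last by rewrite memv_img // memvf.
  by move=> u um; rewrite adE orth.
split; first by move=> x y xm ym; apply: nm => //; apply: (subvP mn).
split=> //; exists a; split=> //; split=> //.
  split=> //.
  - by split; apply/graded_stableP.
  - by move=> x xl; apply: (subvP low); apply/gpartP.
  - by move=> x /(subvP neg)/gpartP; apply.
split=> //.
have imE : lie_img n e = kperp (m + centralizer e).
  apply/eqP; rewrite eqEsubv; apply/andP; split; apply/subvP => x.
    move=> /A3[xm /memv_imgP[y _ xE]]; apply/kperpP => z /memv_addP[u um [w /centralizerP ew ->]].
    by rewrite killingDr xm // xE adE killing_lie ew killing0r oppr0 addr0.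
  move=> /kperpP xP; apply/A3; split.
    by move=> u um; apply: xP; apply: (subvP (addvSl _ _)).
  suff <- : kperp (centralizer e) = lie_img fullv e.
    by apply/kperpP => z zc; apply: xP; apply: (subvP (addvSr _ _)).
  apply/esym/eqP; rewrite eqEdim; apply/andP; split.
    apply/subvP => _ /memv_imgP[y _ ->]; apply/kperpP => z /centralizerP ez.
    by rewrite adE killing_lie ez killing0r oppr0.
  rewrite -(leq_add2r (\dim (centralizer e))) dim_kperp // addnC.
  by rewrite -(limg_ker_dim (ad e) fullv) capfv.
have dn : \dim (lie_img n e) = \dim n by apply: limg_dim_eq.
have mcap : (m :&: centralizer e = 0)%VS.
  by apply/eqP; rewrite -subv0 -ncap; apply: capvS.
have := dim_kperp (m + centralizer e) nd.
rewrite -imE dn dimv_disjoint_sum // addnA => <-.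
by rewrite addnK addnC.
Qed.

Lemma rel_adm_data T a m n : e != 0 -> idiag T -> e \in egr T a ->
  admissible_rel e (egr T) (m, n) -> adm_data T a m n.
Proof.
move=> e0 iT ea [sm [sn [a' [a1 [ea' [[gm gn] low mn neg] A3 [cap nm _]]]]]].
(* A nonzero [e] has only one degree. *)
have aa : a' = a.
  have /egrP := ea; have /egrP := ea' => -> /eqP.
  rewrite -subr_eq0 -scalerBl scaler_eq0 (negPf e0) orbF -rmorphB intr_eq0 subr_eq0.
  by move/eqP.
rewrite aa in low; split=> //.
- exact/graded_stableP.
- exact/graded_stableP.
- by apply/subvP => x /gpartP xl; apply: low; apply: xl.
- by apply/subvP => x /neg xn; apply/gpartP.
- move=> y u yn um; have /A3[h _] : lie e y \in lie_img n e by rewrite -adE memv_img.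
  exact: h.
- move=> y yP; have : lie e y \in lie_img n e.
    by apply/A3; split=> //; rewrite -adE memv_img // memvf.
  case/memv_imgP => z zn; rewrite adE => yz; rewrite -(subrK z y) addrC memv_add //.
  by apply/centralizerP; rewrite lieBr yz subrr.
move=> x xn ex; apply/eqP; rewrite -memv0 -cap memv_cap xn.
exact/centralizerP.
Qed.

Lemma adm_comparable T a m n m' n' : derivation T -> idiag T -> 1 < a ->
  e \in egr T a -> adm_data T a m n -> adm_data T a m' n' ->
  (m <= m')%VS -> (n' <= n)%VS -> comparable_pairs e (m, n) (m', n').
Proof.
move=> dT iT a1 ea p p' mm nn; exists (egr T); split; first exact: egr_grading.
split; first exact: adm_data_rel p.
split; first exact: adm_data_rel p'.
by left; split=> //=; case: p'.
Qed.

Ltac int_lia H := rewrite /=; move: H; clear; lia.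

(** * Admissible pairs around the middle degree of one grading *)

Section FixedGrading.
Variables (T : 'End(L)) (a : int).
Hypotheses (dT : derivation T) (iT : idiag T) (a1 : 1 < a) (ea : e \in egr T a).
Hypothesis ho : half_optimal T a e.

Let M := gpart T (fun j => j *+ 2 < - a).
Let V := gpart T (fun j => j *+ 2 == - a).
Let Q := gpart T (fun j => j *+ 2 <= - a).

Let MQ : (M <= Q)%VS. Proof. by apply: gpartS => // j; int_lia a1. Qed.
Let VQ : (V <= Q)%VS. Proof. by apply: gpartS => // j; int_lia a1. Qed.

Let sM : stable T M. Proof. exact: stable_gpart. Qed.
Let sc : stable T (centralizer e). Proof. exact: stable_centralizer ea. Qed.

(** [V] sits in one degree, so each of its subspaces is graded; this is what leaves [W] free. *)
Let V_scalar x : x \in V -> T x = (- a%:~R / 2%:R) *: x.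
Proof.
move: x; apply: gpart_ind => //; first by rewrite linear0 scaler0.
  by move=> x y xE yE; rewrite linearD /= xE yE scalerDr.
move=> j x /eqP ja /egrP->; congr (_ *: _).
by rewrite -rmorphN -ja rmorphMn /= -mulr_natr mulfK // pnatr_eq0.
Qed.

Let stable_subV U : (U <= V)%VS -> stable T U.
Proof. by move/subvP => UV x xU; rewrite V_scalar ?UV // memvZ. Qed.

Lemma killing_e_gpart (P P' : pred int) y u :
  (forall i j, P i -> P' j -> a + i + j != 0) ->
  y \in gpart T P -> u \in gpart T P' -> killing (lie e y) u = 0.
Proof.
move=> PP yP uP; apply: (killing_gpart dT iT (P := fun i => P (i - a)) _ _ uP).
  by move=> i j Pi Pj; have := PP _ _ Pi Pj; rewrite [a + _]addrC subrK.
move: y yP; apply: gpart_ind => //; first by rewrite lie0r mem0v.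
  by move=> x y hx hy; rewrite lieDr memvD.
move=> j x Pj xj; apply: (gpart_mem iT (lie_egr dT ea xj)).
by rewrite addrAC subrr add0r.
Qed.

(** The orthogonal of [m] for the form [killing (lie e y) u] is stable under [T], so it can be
    tested degree by degree. *)
Lemma orth_homogeneous m W : stable T m ->
  (forall i y, (forall u, u \in m -> killing (lie e y) u = 0) ->
     y \in egr T i -> y \in W) ->
  forall y, (forall u, u \in m -> killing (lie e y) u = 0) -> y \in W.
Proof.
move=> sm hom y0 y0P; pose Y := ((ad e) @^-1: kperp m)%VS.
have YP y : reflect (forall u, u \in m -> killing (lie e y) u = 0) (y \in Y).
  by rewrite -memv_preim adE; apply: kperpP.
have sY : stable T Y.
  move=> y /YP yP; apply/YP => u um.
  have := dT e y; have /egrP -> := ea; rewrite lieZl => /eqP.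
  rewrite addrC -subr_eq => /eqP <-.
  rewrite killingBl (killing_der _ _ dT) killingZl !yP ?mulr0 ?subr0 ?oppr0 //.
  exact: sm.
apply: (idiag_ind iT sY (Q := fun y => y \in W)).
- exact: mem0v.
- by move=> x y; apply: memvD.
- by move=> i y /YP yP; apply: hom.
exact/YP.
Qed.

(** The form pairs degree [i] with degree [- a - i]. Hence above the middle, orthogonality to [M]
    already forces [y] into the centralizer, below it [y] is in [M], and only the middle degree
    imposes conditions on [m0] and [n0]. Brackets inside [Q] have degree at most [- a] and so fall
    into [M]. *)
Lemma adm_mid m0 n0 : (m0 <= n0)%VS -> (n0 <= V)%VS ->
  (forall x, x \in n0 -> lie e x = 0 -> x = 0) ->
  (forall y u, y \in n0 -> u \in m0 -> killing (lie e y) u = 0) ->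
  (forall y, y \in V -> (forall u, u \in m0 -> killing (lie e y) u = 0) ->
     y \in (n0 + centralizer e)%VS) ->
  adm_data T a (M + m0) (M + n0).
Proof.
move=> mn nV inj orth osub.
have nQ : (M + n0 <= Q)%VS by rewrite subv_add MQ (subv_trans nV).
have mnM : (M + m0 <= M + n0)%VS by apply: addvS.
have sn0 := stable_subV nV.
have sm0 := stable_subV (subv_trans mn nV).
have brM x y : x \in Q -> y \in Q -> lie x y \in M.
  by move=> xQ yQ; apply: lie_gpart dT iT _ xQ yQ => i j; int_lia a1.
split=> //.
- exact: stableD.
- exact: stableD.
- apply: subv_trans (addvSl _ _); apply: gpartS => // j; int_lia a1.
- by apply: subv_trans nQ _; apply: gpartS => // j; int_lia a1.
- move=> _ _ /memv_addP[y yM [w wn ->]] /memv_addP[z zM [u um ->]].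
  have wQ : w \in Q by apply: (subvP VQ); apply: (subvP nV).
  have uQ : u \in Q by apply/(subvP VQ)/(subvP nV)/(subvP mn).
  rewrite lieDr killingDl !killingDr (orth w u) // addr0.
  rewrite (killing_e_gpart _ yM zM); last by move=> i j; int_lia a1.
  rewrite (killing_e_gpart _ yM uQ); last by move=> i j; int_lia a1.
  by rewrite (killing_e_gpart _ wQ zM) ?addr0 // => i j; int_lia a1.
- apply: orth_homogeneous; first exact: stableD.
  move=> i y yP yi.
  have [lt|gt|eq] := ltrgtP (i *+ 2) (- a).
  * apply: (subvP (addvSl _ _)); apply: (subvP (addvSl _ _)).
    exact: gpart_mem yi lt.
  * apply: (subvP (addvSr _ _)); apply/centralizerP; apply: nd => z.
    apply: (idiag_ind iT (@stablef _ _ T) (Q := fun z => killing (lie e y) z = 0)) (memvf z).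
    - by rewrite killing0r.
    - by move=> x1 x2 h1 h2; rewrite killingDr h1 h2 addr0.
    move=> j {}z _ zj; have [aij|aij] := eqVneq (a + i + j) 0; last first.
      exact: killing_egr dT (lie_egr dT ea yi) zj aij.
    apply: yP; apply: (subvP (addvSl _ _)); apply: (gpart_mem iT zj); move: gt aij; int_lia a1.
  rewrite -addvA; apply: (subvP (addvSr _ _)); apply: osub.
    by apply: (gpart_mem iT yi); rewrite eq.
  by move=> u um; apply: yP; apply: (subvP (addvSr _ _)).
- have sI : stable T ((M + n0) :&: centralizer e).
    by apply: stableI => //; apply: stableD.
  move=> x xn ex; apply: (idiag_ind iT sI (Q := fun x => x = 0)) => //.
  + by move=> u v -> ->; rewrite addr0.
  + move=> i y /memv_capP[yn /centralizerP ey] yi.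
    have [u [v [uM vn ui vi yE]]] := egr_add_split iT sM sn0 yi yn.
    case: (egr_gpart iT ui uM) => [lt|u0].
      by apply: ho => //; apply: gpart_mem yi lt.
    by move: ey; rewrite yE u0 add0r; apply: inj.
  by rewrite memv_cap xn; apply/centralizerP.
- move=> x y xn ym; apply: (subvP (addvSl _ _)); apply: brM; first exact: (subvP nQ).
  by apply/(subvP nQ)/(subvP mnM).
by move=> x y xn yn; apply: (subvP (addvSl _ _)); apply: brM; apply: (subvP nQ).
Qed.

Definition cmpl W : Prop :=
  [/\ (W <= V)%VS, forall x, x \in W -> lie e x = 0 -> x = 0 &
      forall y, y \in V -> y \in (W + centralizer e)%VS].

Lemma adm_canonical W : cmpl W -> adm_data T a M (M + W).
Proof.
case=> WV inj sp; rewrite -{1}[M]addv0; apply: adm_mid => //.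
- exact: sub0v.
- by move=> y u _; rewrite memv0 => /eqP->; rewrite killing0r.
by move=> y yV _; apply: sp.
Qed.

Lemma cmpl_extend U : (U <= V)%VS -> (forall x, x \in U -> lie e x = 0 -> x = 0) ->
  exists2 W, cmpl W & (U <= W)%VS.
Proof.
move=> UV inj; pose r := (V :&: centralizer e)%VS.
exists (U + (V :\: (U + r)))%VS; last exact: addvSl.
split.
- by rewrite subv_add UV diffvSl.
- move=> x /memv_addP[u uU [w wD xE]] ex.
  have xV : x \in V.
    by rewrite xE memvD //; [apply: (subvP UV) | apply: (subvP (diffvSl _ _)) wD].
  have w0 : w = 0.
    apply/eqP; rewrite -memv0 -(capv_diff V (U + r)) memv_cap wD /=.
    rewrite -(addKr u w) -xE memv_add ?memvN //.
    by rewrite memv_cap xV; apply/centralizerP.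
  by rewrite xE w0 addr0 in ex *; apply: inj.
move=> y yV; have : y \in (V :\: (U + r) + (U + r))%VS.
  by rewrite addv_diff; apply: (subvP (addvSl _ _)).
rewrite addvA [(_ :\: _ + U)%VS]addvC; apply/subvP/addvS => //; exact: capvSr.
Qed.

(** [W] is chosen to contain [n :&: V], so that the middle part of [M + W + n] is just [W], where
    [ad e] is injective. Brackets of [M + W] with [M] have degree at most [- a], hence stay in
    [m]. *)
Lemma adm_to_canonical m n : adm_data T a m n ->
  exists2 W, cmpl W & equivalent_pairs e (m, n) (M, M + W)%VS.
Proof.
move=> pmn; have [sm sn low mn neg orth osub inj nm nn] := pmn.
have [|x /memv_capP[xn _]|W cW nVW] := @cmpl_extend (n :&: V)%VS.
- exact: capvSr.
- exact: inj.
exists W => //; have [WV Winj Wsp] := cW.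
have sW := stable_subV WV.
have WQ := subv_trans WV VQ.
have QneM x y : x \in Q -> y \in gpart T (fun j => j < 0)%R -> lie x y \in M.
  by move=> xQ yQ; apply: lie_gpart dT iT _ xQ yQ => i j; int_lia a1.
have MWQ : (M + W <= Q)%VS by rewrite subv_add MQ.
have lowM : (gpart T (fun j => j <= - a)%R <= M)%VS by apply: gpartS => // j; int_lia a1.
have Qneg : (Q <= gpart T (fun j => j < 0)%R)%VS by apply: gpartS => // j; int_lia a1.
have QMlow x y : x \in Q -> y \in M -> lie x y \in gpart T (fun j => j <= - a)%R.
  by move=> xQ yM; apply: lie_gpart dT iT _ xQ yM => i j; int_lia a1.
have nMM x y : x \in n -> y \in M -> lie x y \in M.
  move=> /(subvP neg) xn yM; rewrite lieC memvN; apply: QneM => //.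
  exact: (subvP MQ).
have p' : adm_data T a (m :&: M) (M + W + n).
  split.
  - exact: stableI.
  - by apply: stableD => //; apply: stableD.
  - by rewrite subv_cap low lowM.
  - by apply: subv_trans (capvSl _ _) (subv_trans mn (addvSr _ _)).
  - by rewrite subv_add neg (subv_trans MWQ Qneg).
  - move=> _ u /memv_addP[y yMW [v vn ->]] /memv_capP[um uM].
    rewrite lieDr killingDl (orth v u) // addr0.
    by apply: (killing_e_gpart _ (subvP MWQ y yMW) uM) => i j; int_lia a1.
  - apply: orth_homogeneous; first exact: stableI.
    move=> i y yP yi; rewrite -(addvA (M + W)%VS).
    have [lt|gt|eq] := ltrgtP (i *+ 2) (- a).
    * apply: (subvP (addvSl _ _)); apply: (subvP (addvSl _ _)).
      exact: gpart_mem yi lt.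
    (* Above the middle degree [y] pairs only with degrees below it, so orthogonality to [m :&: M]
       amounts to orthogonality to [m]. *)
    * apply: (subvP (addvSr _ _)); apply: osub => u.
      apply: (idiag_ind iT sm (Q := fun u => killing (lie e y) u = 0)).
      - by rewrite killing0r.
      - by move=> x1 x2 h1 h2; rewrite killingDr h1 h2 addr0.
      move=> j z zm zj; have [aij|aij] := eqVneq (a + i + j) 0; last first.
        exact: killing_egr dT (lie_egr dT ea yi) zj aij.
      by apply: yP; rewrite memv_cap zm; apply: (gpart_mem iT zj); move: gt aij; int_lia a1.
    have yV : y \in V by apply: (gpart_mem iT yi); rewrite eq.
    apply: subvP (Wsp _ yV); apply: addvS; first exact: addvSr.
    exact: addvSr.
  - have sI : stable T ((M + W + n) :&: centralizer e).
      by apply: stableI => //; apply: stableD => //; apply: stableD.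
    move=> x xn ex; apply: (idiag_ind iT sI (Q := fun x => x = 0)) => //.
    + by move=> u v -> ->; rewrite addr0.
    + move=> i y /memv_capP[yn /centralizerP ey] yi.
      have [t [v [tMW vn ti vi yE]]] := egr_add_split iT (stableD sM sW) sn yi yn.
      have [u [w [uM wW ui wi tE]]] := egr_add_split iT sM sW ti tMW.
      case: (egr_gpart iT ui uM) => [lt|u0].
        by apply: ho => //; apply: gpart_mem yi lt.
      rewrite {}tE {}u0 add0r in yE.
      case: (egr_gpart iT wi (subvP WV w wW)) => [eq|w0].
        apply: Winj => //; rewrite yE memvD //; apply: (subvP nVW).
        by rewrite memv_cap vn; apply: gpart_mem vi eq.
      by move: ey; rewrite yE w0 add0r; apply: inj.
    by rewrite memv_cap xn; apply/centralizerP.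
  - move=> _ y /memv_addP[x xMW [v vn ->]] /memv_capP[ym yM].
    have xQ := subvP MWQ _ xMW.
    rewrite lieDl memvD // memv_cap; last by rewrite nm // nMM.
    by have h := QMlow _ _ xQ yM; rewrite (subvP low) // (subvP lowM).
  move=> _ _ /memv_addP[x xMW [v vn ->]] /memv_addP[y yMW [w wn ->]].
  have xQ := subvP MWQ _ xMW; have yQ := subvP MWQ _ yMW.
  rewrite lieDl !lieDr !memvD //.
  + apply: (subvP (addvSl _ _)); apply: (subvP (addvSl _ _)); apply: QneM => //.
    exact: (subvP Qneg).
  + apply: (subvP (addvSl _ _)); apply: (subvP (addvSl _ _)); apply: QneM => //.
    exact: (subvP neg).
  + apply: (subvP (addvSl _ _)); apply: (subvP (addvSl _ _)).
    by rewrite lieC memvN; apply: QneM => //; apply: (subvP neg).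
  by apply: (subvP (addvSr _ _)); apply: nn.
apply: (@equivalent_pairs_trans _ _ _ (m :&: M, M + W + n)%VS).
  apply/comparable_equivalent/comparable_pairs_sym.
  by apply: (adm_comparable dT iT a1 ea p' pmn); [apply: capvSl | apply: addvSr].
apply/comparable_equivalent.
apply: (adm_comparable dT iT a1 ea p' (adm_canonical cW)); first exact: capvSr.
exact: addvSl.
Qed.

(** Against [[e, V]] only the middle component of [u] is visible. *)
Let V_killing_proj u : (exists j : int, j *+ 2 = - a) ->
  exists2 v, v \in V & forall y, y \in V -> killing (lie e y) v = killing (lie e y) u.
Proof.
case=> j jE; have [p [pE _]] := idiag_proj j iT.
have pV x : p x \in V.
  apply: (idiag_ind iT (@stablef _ _ T) (Q := fun x => p x \in V)) (memvf x).
  - by rewrite linear0 mem0v.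
  - by move=> x1 x2 h1 h2; rewrite linearD memvD.
  move=> i x1 _ xi; rewrite (pE _ _ xi); case: eqP => [ij|_]; last exact: mem0v.
  by apply: (gpart_mem iT xi); rewrite ij jE.
exists (p u); first exact: pV.
move=> y yV; apply: (idiag_ind iT (@stablef _ _ T)
  (Q := fun u => killing (lie e y) (p u) = killing (lie e y) u)) (memvf u).
- by rewrite linear0.
- by move=> x1 x2 h1 h2; rewrite linearD !killingDr h1 h2.
move=> i x _ xi; rewrite (pE _ _ xi); case: eqP => // ij; rewrite killing0r.
apply/esym; apply: (killing_e_gpart (P' := pred1 i) _ yV).
  by move=> k l /eqP kE /eqP ->; move: a1 kE jE ij; clear; lia.
by apply: (gpart_mem iT xi); exact: eqxx.
Qed.

Let V_half w : w \in V -> w != 0 -> exists j : int, j *+ 2 = - a.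
Proof.
move=> wV w0; have [//|nj] := pselect (exists j : int, j *+ 2 = - a).
have : (V <= 0)%VS by apply: gpart_sub => // j /eqP jE; case: nj; exists j.
by move/subvP/(_ w wV); rewrite memv0 (negPf w0).
Qed.

(* The line through [u] is the radical of the form [killing (lie e y) u] on the
   hyperplane [n0] of [W]; it lies in [n0] since the form is alternating. *)
Let hyperplane_radical W n0 w : cmpl W -> W = (n0 + <[w]>)%VS -> w \notin n0 ->
  exists u, [/\ u \in n0, forall y, y \in n0 -> killing (lie e y) u = 0 &
                killing (lie e w) u != 0].
Proof.
move=> [WV inj sp] WE wn.
have nW : (n0 <= W)%VS by rewrite WE addvSl.
have wW : w \in W by rewrite WE (subvP (addvSr _ _)) // memv_line.
have wV : w \in V by apply: (subvP WV).
have w0 : w != 0 by apply: contraNneq wn => ->; exact: mem0v.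
have ewn : lie e w \notin lie_img n0 e.
  apply/negP => /memv_imgP[v vn]; rewrite adE => wv; move/negP: wn; apply.
  rewrite -[w](subrK v); have -> : w - v = 0; last by rewrite add0r.
  apply: inj; last by rewrite lieBr wv subrr.
  by apply: memvB wW _; apply: (subvP nW).
have [u0 u0P u0w] : exists2 u0, u0 \in kperp (lie_img n0 e) & killing (lie e w) u0 != 0.
  apply: contrapT => nex; move/negP: ewn; apply.
  rewrite -(kperpK (lie_img n0 e) nd); apply/kperpP => z zP.
  by apply/eqP; apply: contrapT => /negP h; apply: nex; exists z.
(* The vector [u0] is moved into [V], then into [W] by dropping a part in the centralizer; neither
   changes its pairing with [[e, V]]. *)
have [u1 u1V u1E] := V_killing_proj u0 (V_half wV w0).
have /memv_addP[u uW [z /centralizerP ez u1uz]] := sp _ u1V.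
have uE y : y \in V -> killing (lie e y) u = killing (lie e y) u0.
  move=> yV; rewrite -u1E // u1uz killingDr [X in _ + X]killing_lie ez.
  by rewrite killing0r oppr0 addr0.
have un y : y \in n0 -> killing (lie e y) u = 0.
  move=> yn; rewrite uE; last by apply/(subvP WV)/(subvP nW).
  by rewrite killingC; apply/(kperpP _ _ u0P); rewrite -adE memv_img.
have uw : killing (lie e w) u != 0 by rewrite uE.
exists u; split=> //.
have alt : killing (lie e u) u = 0.
  apply/eqP; have /eqP : killing (lie e u) u = - killing (lie e u) u.
    by rewrite {1}killing_lie killingC.
  by rewrite -addr_eq0 -mulr2n mulrn_eq0.
move: uW alt; rewrite WE => /memv_addP[v vn [_ /vlineP[t ->] uvw]].
rewrite {1}uvw lieDr killingDl un // add0r lieZr killingZl => /eqP.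
rewrite mulf_eq0 (negPf uw) orbF => /eqP t0.
by rewrite uvw t0 scale0r addr0.
Qed.

Let adm_hyperplane W n0 w u : cmpl W -> W = (n0 + <[w]>)%VS -> u \in n0 ->
  (forall y, y \in n0 -> killing (lie e y) u = 0) -> killing (lie e w) u != 0 ->
  adm_data T a (M + <[u]>) (M + n0).
Proof.
move=> [WV inj sp] WE un nu wu.
have nW : (n0 <= W)%VS by rewrite WE addvSl.
apply: adm_mid.
- by apply/subvP => _ /vlineP[t ->]; apply: memvZ.
- exact: subv_trans nW WV.
- by move=> x xn; apply: inj; apply: (subvP nW).
- by move=> y _ yn /vlineP[t ->]; rewrite killingZr nu // mulr0.
move=> y /sp; rewrite {1}WE => /memv_addP[x /memv_addP[v vn [_ /vlineP[t ->] ->]] [z zc ->]].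
move=> /(_ u (memv_line u)) /eqP; rewrite !lieDr !killingDl nu // add0r lieZr killingZl.
rewrite (centralizerP _ zc) killing0l addr0.
rewrite mulf_eq0 (negPf wu) orbF => /eqP ->; rewrite scale0r addr0.
exact: memv_add.
Qed.

Let adm_canonical_comparable W n0 u : cmpl W -> (n0 <= W)%VS ->
  adm_data T a (M + <[u]>) (M + n0) ->
  equivalent_pairs e (M, M + W)%VS (M + <[u]>, M + n0)%VS.
Proof.
move=> cW nW p; apply: comparable_equivalent.
by apply: (adm_comparable dT iT a1 ea (adm_canonical cW) p); [exact: addvSl | exact: addvS].
Qed.

(** Exchange argument: a vector [w] of [W] outside [W'] is traded for the [w'] of [W'] congruent to
    it modulo the centralizer. The hyperplane [n0] kept from [W] contains [W :&: W'], so the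
    intersection with [W'] grows. *)
Lemma canonical_equivalent W W' : cmpl W -> cmpl W' ->
  equivalent_pairs e (M, M + W)%VS (M, M + W')%VS.
Proof.
have [k] := ubnP (\dim V - \dim (W :&: W'))%N; elim: k => // k IHk in W *.
move=> lek cW cW'; have [WV inj sp] := cW; have [WV' inj' sp'] := cW'.
have [WW|] := boolP (W <= W')%VS.
  suff -> : W = W'.
    apply: equivalent_pairs_refl; exists (egr T); split; first exact: egr_grading.
    exact: adm_data_rel (adm_canonical cW').
  apply/eqP; rewrite eqEsubv WW; apply/subvP => x xW'.
  have /memv_addP[y yW [z /centralizerP ez xyz]] := sp _ (subvP WV' x xW').
  suff z0 : z = 0 by rewrite xyz z0 addr0.
  by apply: inj' ez; rewrite -(addKr y z) -xyz addrC memvB // (subvP WW).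
case/subvPn=> w wW wW'.
pose X := (W :&: W')%VS; pose D := (W :\: (X + <[w]>))%VS; pose n0 := (X + D)%VS.
have DW : (D <= W)%VS by exact: diffvSl.
have nW : (n0 <= W)%VS by rewrite subv_add capvSl.
have WE : W = (n0 + <[w]>)%VS.
  rewrite /n0 -addvA [(D + _)%VS]addvC addvA addvC addv_diff addvC.
  apply/esym/addv_idPr; rewrite subv_add capvSl; exact: wW.
have wn : w \notin n0.
  apply/negP => /memv_addP[c cX [d dD wcd]].
  have d0 : d = 0.
    apply/eqP; rewrite -memv0 -(capv_diff W (X + <[w]>)) memv_cap dD /=.
    by rewrite -(addKr c d) -wcd memv_add ?memvN // memv_line.
  by move: cX; rewrite memv_cap -[c]addr0 -d0 -wcd (negPf wW') andbF.
have /memv_addP[w' w'W' [z /centralizerP ez wE]] := sp' _ (subvP WV w wW).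
have ew t v : lie e (v + t *: w') = lie e (v + t *: w).
  by rewrite wE !lieDr !lieZr lieDr ez addr0.
pose W2 := (n0 + <[w']>)%VS.
have cW2 : cmpl W2.
  split.
  - rewrite subv_add (subv_trans nW) //=; exact: (subvP WV').
  - move=> _ /memv_addP[v vn [_ /vlineP[t ->] ->]]; rewrite ew => /inj vtw.
    have vtw0 : v + t *: w = 0 by apply: vtw; rewrite WE memv_add // memvZ // memv_line.
    have t0 : t = 0.
      apply/eqP; apply: contraNT wn => t0; rewrite -(scale1r w) -(mulVf t0) -scalerA.
      by rewrite memvZ // -(addKr v (t *: w)) vtw0 addr0 memvN.
    by move: vtw0; rewrite t0 !scale0r !addr0.
  move=> y /sp; rewrite {1}WE.
  case/memv_addP=> _ /memv_addP[v vn [_ /vlineP[t ->] ->]] [x /centralizerP ex ->].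
  have -> : v + t *: w + x = (v + t *: w') + (t *: z + x).
    by rewrite wE scalerDr !addrA.
  apply: memv_add.
    by apply: memv_add => //; rewrite memvZ // memv_line.
  by apply/centralizerP; rewrite lieDr lieZr ez ex scaler0 addr0.
have [u [un nu wu]] := hyperplane_radical cW WE wn.
have pu := adm_hyperplane cW WE un nu wu.
apply: (@equivalent_pairs_trans _ _ _ (M, M + W2)%VS).
  apply: (equivalent_pairs_trans (adm_canonical_comparable cW nW pu)).
  apply: equivalent_pairs_sym; apply: adm_canonical_comparable pu => //.
  exact: addvSl.
apply: IHk => //; rewrite ltnS in lek; apply: leq_trans lek.
have sub : (X <= W2 :&: W')%VS.
  by rewrite subv_cap capvSr andbT; apply: subv_trans (addvSl _ _) (addvSl _ _).
have w'in : w' \in (W2 :&: W')%VS.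
  by rewrite memv_cap w'W' andbT (subvP (addvSr _ _)) // memv_line.
have w'X : w' \notin X.
  rewrite memv_cap w'W' andbT; apply/negP => w'W; move/negP: wW'; apply.
  suff z0 : z = 0 by rewrite wE z0 addr0.
  by apply: inj ez; rewrite -(addKr w' z) -wE memvD ?memvN.
have lt : (\dim X < \dim (W2 :&: W'))%N.
  rewrite ltn_neqAle dimvS // andbT; apply: contra w'X => /eqP dd.
  suff -> : X = (W2 :&: W')%VS by [].
  by apply/eqP; rewrite eqEdim sub dd leqnn.
have le : (\dim (W2 :&: W') <= \dim V)%N.
  by apply: dimvS; apply: subv_trans (capvSr _ _) WV'.
by move: lt le; rewrite -/X; clear; lia.
Qed.

Lemma fixed_grading_equivalent p q : e != 0 ->
  admissible_rel e (egr T) p -> admissible_rel e (egr T) q ->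
  equivalent_pairs e p q.
Proof.
case: p q => [m n] [m' n'] e0 /(rel_adm_data e0 iT ea) P /(rel_adm_data e0 iT ea) P'.
have [W cW PW] := adm_to_canonical P; have [W' cW' PW'] := adm_to_canonical P'.
apply: (equivalent_pairs_trans PW); apply: (equivalent_pairs_trans _ (equivalent_pairs_sym PW')).
exact: canonical_equivalent.
Qed.

End FixedGrading.

End AdmissiblePairs.

(** * Deformation to a Dynkin grading *)

(* The degree of the bidegree [(i, j)] in the [k]-th grading of a chain of
   length [N], shifted so that the middle degree becomes [0]. *)
Definition shifted_degree (N a k i j : int) : int :=
  2 * k * i + (N - k) * a * j + N * a.

(* Since [N / 2] is divisible by [2 i - a j], the shifted degree is an integer
   multiple of an integer of the same parity as [k], so it cannot change sign
   strictly between two consecutive values of [k]. *)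
Lemma shifted_degree_sign (D : nat) (a i j l k : int) :
  `|2 * i - a * j| <= D%:Z -> k = 2 * l \/ k = 2 * l + 2 ->
  let N := 2 * (D`!)%:Z in
  (shifted_degree N a k i j < 0 -> shifted_degree N a (2 * l + 1) i j < 0) /\
  (shifted_degree N a (2 * l + 1) i j <= 0 -> shifted_degree N a k i j <= 0).
Proof.
move=> qD kl N; rewrite /shifted_degree; set q := 2 * i - a * j in qD.
have phiE k' : 2 * k' * i + (N - k') * a * j + N * a = k' * q + N * a * (j + 1).
  by rewrite /q; ring.
rewrite !phiE.
have [-> //|q0] := eqVneq q 0; first by rewrite !mulr0; split.
have [c cE] : exists c, (D`!)%:Z = q * c.
  have /dvdnP[c cE] : (`|q|%N %| D`!)%N.
    by apply: dvdn_fact; move: qD q0; clear; lia.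
  exists (Num.sg q * c%:Z); rewrite cE PoszM mulrCA mulrA mulrC abszE.
  by rewrite -normrEsg mulrC.
have uE k' : k' * q + N * a * (j + 1) = q * (k' + 2 * (c * a * (j + 1))).
  by rewrite /N cE; ring.
rewrite !uE; set w := c * a * (j + 1).
have [qneg|qpos|] := ltrgtP q 0; last by move=> qq; rewrite qq eqxx in q0.
  rewrite !nmulr_rlt0 // !nmulr_rle0 //; move: kl; clear; lia.
rewrite !pmulr_rlt0 // !pmulr_rle0 //; move: kl; clear; lia.
Qed.

Fact int_comb_key : unit. Proof. exact: tt. Qed.

(* Locked, since comparing unfolded linear maps up to conversion is costly. *)
Definition int_comb (K : numFieldType) (L : lieAlgType K) (f g : 'End(L))
    (al be : int) : 'End(L) :=
  locked_with int_comb_key (al%:~R *: f + be%:~R *: g).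

Lemma int_combE (K : numFieldType) (L : lieAlgType K) (f g : 'End(L)) al be x :
  int_comb f g al be x = al%:~R *: f x + be%:~R *: g x.
Proof. by rewrite /int_comb locked_withE add_lfunE !scale_lfunE. Qed.

Section Bigrading.
Variables (K : numClosedFieldType) (L : lieAlgType K).
Hypothesis nd : killing_nondeg L.
Variables (e h f : L) (T : 'End(L)) (a : int).
Hypotheses (dT : derivation T) (iT : idiag T) (a1 : 1 < a) (ea : e \in egr T a).
Hypotheses (e0 : e != 0) (en : lie_nilpotent e) (ho : half_optimal T a e).
Hypotheses (tr : sl2_triple e h f) (h0 : h \in egr T 0).

Let H := ad h.
Let iH : idiag H. Proof. exact: sl2_idiag tr en. Qed.
Let dH : derivation H. Proof. exact: ad_derivation. Qed.
Let eH : e \in egr H 2. Proof. exact: sl2_e_egr tr. Qed.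

Let TH x : T (H x) = H (T x).
Proof. by rewrite !adE dT (egrP _ _ _ h0) scale0r lie0l add0r. Qed.

Definition commutes_TH (S : 'End(L)) : Prop :=
  (forall x, T (S x) = S (T x)) /\ (forall x, H (S x) = S (H x)).

Let cT : commutes_TH T. Proof. by split=> x; rewrite ?TH. Qed.
Let cH : commutes_TH H. Proof. by split=> x; rewrite ?TH. Qed.

Let bihomogeneous_ind (U : {vspace L}) (Q : L -> Prop) : stable T U -> stable H U ->
  Q 0 -> (forall x y, Q x -> Q y -> Q (x + y)) ->
  (forall i j x, x \in U -> x \in egr T i -> x \in egr H j -> x != 0 -> Q x) ->
  forall x, x \in U -> Q x.
Proof.
move=> sT sH Q0 QD QE; apply: (idiag_ind iT sT) => // i x xU xi.
have sU : stable H (U :&: egr T i).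
  by apply: stableI sH _; apply: stable_egr => y; rewrite TH.
apply: (idiag_ind iH sU) => //; last by rewrite memv_cap xU.
move=> j y /memv_capP[yU yi] yj; have [->//|y0] := eqVneq y 0.
exact: QE yi yj y0.
Qed.

Let comb := int_comb T H.

Let comb_egr al be i j x : x \in egr T i -> x \in egr H j ->
  x \in egr (comb al be) (al * i + be * j).
Proof.
move=> /egrP xi /egrP xj; apply/egrP; rewrite int_combE xi xj.
by rewrite !scalerA -scalerDl -!rmorphM -rmorphD.
Qed.

Let comb_derivation al be : derivation (comb al be).
Proof. by rewrite /comb /int_comb locked_withE; apply: derivation_lin. Qed.

Let comb_commutes al be : commutes_TH (comb al be).
Proof.
by split=> x; rewrite !int_combE linearD !linearZ /= ?TH.
Qed.

Let comb_idiag al be : idiag (comb al be).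
Proof.
move=> x; apply: (bihomogeneous_ind (@stablef _ _ T) (@stablef _ _ H)
  (Q := in_gsum (egr (comb al be)) predT)) (memvf x).
- exact: in_gsum0.
- exact: in_gsumD.
move=> i j y _ yi yj _; exact: in_gsum_mem (comb_egr al be yi yj) isT.
Qed.

(** Finiteness of the set of bidegrees; this [D] determines the length of the chain. *)
Let bidegree_bound : exists D : nat, forall i j x, x \in egr T i -> x \in egr H j ->
  x != 0 -> `|2 * i - a * j| <= D%:Z.
Proof.
have [s [_ [_ s0]]] := idiag_support iT; have [t [_ [_ t0]]] := idiag_support iH.
pose N1 := (\max_(i <- s) `|i|%N)%N; pose N2 := (\max_(j <- t) `|j|%N)%N.
exists (2 * N1 + `|a|%N * N2)%N => i j x xi xj x0.
have is_ : i \in s.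
  by apply: contraNT x0 => /s0 z; move: xi; rewrite z memv0.
have jt : j \in t.
  by apply: contraNT x0 => /t0 z; move: xj; rewrite z memv0.
have iN : (`|i|%N <= N1)%N by exact: leq_bigmax_seq is_ isT.
have jN : (`|j|%N <= N2)%N by exact: leq_bigmax_seq jt isT.
have ajN : (absz (a * j)%R <= absz a * N2)%N by rewrite abszM leq_mul.
move: iN ajN; move: (a * j) (absz a * N2)%N N1; clear; lia.
Qed.

Section Chain.
Variables (D : nat).
Hypothesis bound : forall i j x, x \in egr T i -> x \in egr H j -> x != 0 ->
  `|2 * i - a * j| <= D%:Z.

Let N := 2 * (D`!)%:Z.
Let N_gt0 : 0 < N. Proof. by rewrite /N; have := fact_gt0 D; clear; lia. Qed.

(** With these weights [e] has degree [2 k a + 2 (N - k) a = 2 N a] for every [k]. The ends are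
    [N a (ad h)] at [k = 0] and [2 N T] at [k = N]. *)
Let Tk (k : int) := comb (2 * k) ((N - k) * a).
Let ak := 2 * (N * a).

Let Na_gt0 : 1 <= N * a.
Proof. by have : 0 < N * a by rewrite mulr_gt0 // (lt_trans _ a1). Qed.

Let ak_gt1 : 1 < ak. Proof. by rewrite /ak; move: Na_gt0; clear; lia. Qed.

Let e_Tk k : e \in egr (Tk k) ak.
Proof.
have -> : ak = 2 * k * a + (N - k) * a * 2 by rewrite /ak; ring.
exact: comb_egr ea eH.
Qed.

Let Mk k := gpart (Tk k) (fun j => j *+ 2 < - ak).
Let Vk k := gpart (Tk k) (fun j => j *+ 2 == - ak).
Let Qk k := gpart (Tk k) (fun j => j *+ 2 <= - ak).

Let Tk_egr k i j x : x \in egr T i -> x \in egr H j ->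
  x \in egr (Tk k) (shifted_degree N a k i j - N * a).
Proof. by move=> xi xj; rewrite addrK; apply: comb_egr. Qed.

Let Tk_stable k P : stable T (gpart (Tk k) P) /\ stable H (gpart (Tk k) P).
Proof.
have [c1 c2] := comb_commutes (2 * k) ((N - k) * a).
by split; [exact: stable_gpart (comb_idiag _ _) c1 | exact: stable_gpart (comb_idiag _ _) c2].
Qed.

(** A bihomogeneous vector of the kernel has shifted degree at least [(N - k) a], which is positive
    for [k < N]; so even the middle degree avoids the centralizer. *)
Let Qk_inj k x : 0 <= k -> k < N -> x \in Qk k -> lie e x = 0 -> x = 0.
Proof.
move=> k0 kN xQ ex; have [sT sH] := Tk_stable k (fun j => j *+ 2 <= - ak).
have sTI : stable T (Qk k :&: centralizer e).
  exact: stableI sT (stable_centralizer dT ea).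
have sHI : stable H (Qk k :&: centralizer e).
  exact: stableI sH (stable_centralizer dH eH).
apply: (bihomogeneous_ind sTI sHI (Q := fun x => x = 0)) => //.
- by move=> y z -> ->; rewrite addr0.
- move=> i j y /memv_capP[yQ /centralizerP ey] yi yj y0.
  have i_ge : - a <= i *+ 2.
    rewrite leNgt; apply/negP => lt; move/eqP: y0; apply.
    by apply: ho ey; apply: gpart_mem yi lt.
  have j_ge := sl2_kernel_ge0 tr en ey yj y0.
  have [] := egr_gpart (comb_idiag _ _) (Tk_egr k yi yj) yQ; last by [].
  rewrite /shifted_degree /ak => le.
  have h1 : 0 <= k * (i *+ 2 + a) by rewrite mulr_ge0 // -[a]opprK subr_ge0.
  have h2 : 0 <= (N - k) * a * j.
    by rewrite !mulr_ge0 // ?subr_ge0 ?ltW // (lt_trans _ a1).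
  have h3 : 0 < (N - k) * a by rewrite mulr_gt0 ?subr_gt0 // (lt_trans _ a1).
  exfalso; move: le h1 h2 h3.
  have -> : 2 * k * i = k * (i *+ 2 + a) - k * a by rewrite -mulr_natr; ring.
  have -> : N * a = (N - k) * a + k * a by ring.
  move: (k * (i *+ 2 + a)) ((N - k) * a * j) ((N - k) * a) (k * a); clear; lia.
by rewrite memv_cap xQ; apply/centralizerP.
Qed.

Let MVQ k : (Mk k + Vk k <= Qk k)%VS.
Proof.
by rewrite subv_add; apply/andP; split; apply: gpartS (comb_idiag _ _) _ => j; clear; lia.
Qed.

Let Tk_half_optimal k : 0 <= k -> k < N -> half_optimal (Tk k) ak e.
Proof.
move=> k0 kN x xM; apply: (Qk_inj k0 kN).
by apply: (subvP (MVQ k)); apply: (subvP (addvSl _ _)).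
Qed.

Let Tk_cmpl k : 0 <= k -> k < N -> cmpl e (Tk k) ak (Vk k).
Proof.
move=> k0 kN; split; first exact: subvv.
  move=> x xV; apply: (Qk_inj k0 kN).
  by apply: (subvP (MVQ k)); apply: (subvP (addvSr _ _)).
by move=> y yV; apply: (subvP (addvSl _ _)).
Qed.

Let pair k : {vspace L} * {vspace L} := (Mk k, Mk k + Vk k)%VS.

Let pair_adm k : 0 <= k -> k < N -> adm_data e (Tk k) ak (Mk k) (Mk k + Vk k).
Proof.
move=> k0 kN; exact: (adm_canonical nd (comb_derivation _ _) (comb_idiag _ _)
  ak_gt1 (e_Tk k) (Tk_half_optimal k0 kN) (Tk_cmpl k0 kN)).
Qed.

(** The orthogonality, injectivity and bracket conditions carry over verbatim; only stability under
    [S] and the two degree bounds have to be checked, the latter on bidegrees. *)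
Let pair_adm_transfer k S al be a' : 0 <= k -> k < N ->
  derivation S -> idiag S -> commutes_TH S -> 1 < a' -> e \in egr S a' ->
  (forall i j x, x \in egr T i -> x \in egr H j -> x \in egr S (al * i + be * j)) ->
  (forall i j, `|2 * i - a * j| <= D%:Z ->
     (al * i + be * j <= - a' -> shifted_degree N a k i j < 0) /\
     (shifted_degree N a k i j <= 0 -> al * i + be * j < 0)) ->
  admissible_rel e (egr S) (pair k).
Proof.
move=> k0 kN dS iS [cS1 cS2] a'1 eS Segr sgn.
have [_ _ _ mn _ orth osub inj nm nn] := pair_adm k0 kN.
have [sTQ sHQ] := Tk_stable k (fun j => j *+ 2 <= - ak).
have ST x : S (Tk k x) = Tk k (S x).
  by rewrite !int_combE linearD !linearZ /= cS1 cS2.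
have iTk := comb_idiag (2 * k) ((N - k) * a).
have sM : stable S (Mk k) by exact: stable_gpart iTk ST.
have sV : stable S (Vk k) by exact: stable_gpart iTk ST.
apply: (adm_data_rel nd dS iS a'1 eS).
split; try solve [exact: stableD | exact: orth | exact: osub | exact: inj | exact: nm | exact: nn | exact: mn | exact: sM].
- apply/subvP => x xP.
  have sT : stable T (gpart S (fun j => j <= - a')%R) by exact: stable_gpart iS cS1.
  have sH : stable H (gpart S (fun j => j <= - a')%R) by exact: stable_gpart iS cS2.
  refine (bihomogeneous_ind sT sH (Q := fun x => x \in Mk k) _ _ _ xP).
  + exact: mem0v.
  + by move=> y z; apply: memvD.
  move=> i j y yP yi yj y0.
  have [le|yy0] := egr_gpart iS (Segr _ _ _ yi yj) yP; last by exfalso; move: y0; rewrite yy0 eqxx.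
  have [lt _] := sgn i j (bound yi yj y0).
  apply: gpart_mem iTk (Tk_egr k yi yj) _; have := lt le; rewrite /ak.
  by move: (shifted_degree _ _ _ _ _) (N * a); clear; lia.
apply: subv_trans (MVQ k) _; apply/subvP => x xQ.
refine (bihomogeneous_ind sTQ sHQ (Q := fun x => x \in gpart S (fun j => j < 0)%R) _ _ _ xQ).
- exact: mem0v.
- by move=> y z; apply: memvD.
move=> i j y yQ yi yj y0.
have [le|yy0] := egr_gpart iTk (Tk_egr k yi yj) yQ; last by exfalso; move: y0; rewrite yy0 eqxx.
have [_ lt] := sgn i j (bound yi yj y0).
apply: gpart_mem iS (Segr _ _ _ yi yj) _; apply: lt; move: le; rewrite /ak.
by move: (shifted_degree _ _ _ _ _) (N * a); clear; lia.
Qed.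

Let pair_adm_neighbour l k : 0 <= l -> 2 * l + 1 < N -> k = 2 * l \/ k = 2 * l + 2 ->
  admissible_rel e (egr (Tk k)) (pair (2 * l + 1)).
Proof.
move=> l0 lN kl; have k0 : 0 <= 2 * l + 1 by move: l0; clear; lia.
apply: (pair_adm_transfer k0 lN (comb_derivation _ _) (comb_idiag _ _)
  (comb_commutes _ _) ak_gt1 (e_Tk k)); first exact: comb_egr.
move=> i j ij; have [h1 h2] := shifted_degree_sign ij kl.
rewrite -[2 * k * i + _](addrK (N * a)) -/(shifted_degree N a k i j) /ak; split.
  by move=> le; apply: h1; move: le Na_gt0; move: (shifted_degree _ _ _ _ _) (N * a); clear; lia.
move/h2; move: Na_gt0; move: (shifted_degree _ _ _ _ _) (N * a); clear; lia.
Qed.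

Let pair_adm_T l : 0 <= l -> 2 * l + 2 = N ->
  admissible_rel e (egr T) (pair (2 * l + 1)).
Proof.
move=> l0 lN; have kl : N = 2 * l \/ N = 2 * l + 2 by right.
have k0 : 0 <= 2 * l + 1 by move: l0; clear; lia.
have kN : 2 * l + 1 < N by move: lN; clear; lia.
apply: (pair_adm_transfer (al := 1) (be := 0) k0 kN dT iT cT a1 ea).
  by move=> i j x xi _; rewrite mul1r mul0r addr0; exact: xi.
move=> i j ij; have [h1 h2] := shifted_degree_sign ij kl.
have sN : shifted_degree N a N i j = N * (2 * i + a) by rewrite /shifted_degree; ring.
rewrite mul1r mul0r addr0; split.
  move=> ia; apply: h1; rewrite sN pmulr_rlt0 //; move: ia a1; clear; lia.
by move/h2; rewrite sN pmulr_rle0 //; move: a1; clear; lia.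
Qed.

Let pair_adm_H : admissible_rel e (egr H) (pair 1).
Proof.
have kl : (0 : int) = 2 * 0 \/ (0 : int) = 2 * 0 + 2 by left; rewrite mulr0.
have N2 : 1 < N by rewrite /N; have := fact_gt0 D; clear; lia.
apply: (pair_adm_transfer (al := 0) (be := 1) (a' := 2) ler01 N2 dH iH cH _ eH).
- by [].
- by move=> i j x _ xj; rewrite mul1r mul0r add0r; exact: xj.
move=> i j ij; have := shifted_degree_sign ij kl; rewrite mulr0 add0r => -[h1 h2].
have sN : shifted_degree N a 0 i j = N * a * (j + 1) by rewrite /shifted_degree; ring.
rewrite mul1r mul0r add0r; split.
  move=> ja; apply: h1; rewrite sN pmulr_rlt0; first by move: ja; clear; lia.
  exact: lt_le_trans Na_gt0.
move/h2; rewrite sN pmulr_rle0; first by clear; lia.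
exact: lt_le_trans Na_gt0.
Qed.

(** Consecutive odd pairs are both admissible relative to the even grading between them, where the
    result for a fixed grading joins them. *)
Let chain (l : nat) : 2 * l%:Z + 2 <= N ->
  equivalent_pairs e (pair 1) (pair (2 * l%:Z + 1)).
Proof.
elim: l => [|l IHl] lN.
  apply: equivalent_pairs_refl; exists (egr H); split; last exact: pair_adm_H.
  exact: egr_grading.
apply: equivalent_pairs_trans (IHl _) _; first by move: lN; clear; lia.
pose k := 2 * l%:Z + 2.
have kN : k < N by rewrite /k; move: lN; clear; lia.
have k0 : 0 <= k by rewrite /k; clear; lia.
apply: (fixed_grading_equivalent nd (comb_derivation _ _) (comb_idiag _ _)
  ak_gt1 (e_Tk k) (Tk_half_optimal k0 kN) e0).
- apply: pair_adm_neighbour; [by clear; lia | by move: kN; rewrite /k; clear; lia | by right].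
apply: pair_adm_neighbour; first by clear; lia.
  by move: lN; clear; lia.
by left; rewrite /k; clear; lia.
Qed.

Lemma chain_equivalent p q : admissible_rel e (egr T) p ->
  admissible_rel e (egr H) q -> equivalent_pairs e p q.
Proof.
(* Then [2 l + 1 = N - 1] is the last odd index, adjacent to the end of the chain where the grading
   is that of [T] up to scaling. *)
move=> pT qH; pose l := (D`!).-1.
have lN : 2 * l%:Z + 2 = N by rewrite /N /l; have := fact_gt0 D; clear; lia.
apply: (equivalent_pairs_trans (q := pair (2 * l%:Z + 1))).
  by apply: (fixed_grading_equivalent nd dT iT a1 ea ho e0 pT); apply: pair_adm_T lN.
apply: (equivalent_pairs_trans (equivalent_pairs_sym (chain _))).
  by rewrite lN.
exact: (fixed_grading_equivalent nd dH iH _ eH (sl2_half_optimal tr en) e0 pair_adm_H).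
Qed.

End Chain.

Lemma dynkin_equivalent p q : admissible_rel e (egr T) p ->
  admissible_rel e (egr H) q -> equivalent_pairs e p q.
Proof. by have [D bound] := bidegree_bound; apply: chain_equivalent bound p q. Qed.

End Bigrading.

(** The degree of [e = 0] is not determined, so this case is kept apart: the centralizer is
    everything, which leaves only the zero pair. *)
Lemma admissible_rel0 (K : fieldType) (L : lieAlgType K) G
    (p : {vspace L} * {vspace L}) :
  admissible_rel 0 G p -> p = (0%VS, 0%VS).
Proof.
case: p => m n [_ [_ [a [_ [_ [_ _ mn _] _ [cap _ _]]]]]].
have cf : centralizer 0 = fullv :> {vspace L}.
  by apply/vspaceP => x; rewrite memvf memv_ker adE lie0l eqxx.
have n0 : n = 0%VS by rewrite -cap cf capvf.
by move: mn; rewrite n0 subv0 => /eqP->.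
Qed.

Lemma half_optimal_equivalent (K : numClosedFieldType) (L : lieAlgType K) (e : L)
    (a : int) (G : int -> {vspace L}) :
  simple_lie L -> lie_nilpotent e -> is_grading G -> 1 < a -> e \in G a ->
  (forall x, in_gsum G (fun j => j *+ 2 < - a) x -> x \in centralizer e -> x = 0) ->
  (forall p q : {vspace L} * {vspace L},
     admissible_rel e G p -> admissible_rel e G q -> equivalent_pairs e p q) /\
  (exists h f : L, sl2_triple e h f /\
     forall p q : {vspace L} * {vspace L},
       admissible_rel e G p -> admissible_rel e (dynkin_grading h) q ->
       equivalent_pairs e p q).
Proof.
move=> sL en Gg a1 ea ho.
have [e0|e0] := eqVneq e 0.
  have refl p q G' : admissible_rel e G p -> admissible_rel e G' q ->
      equivalent_pairs e p q.
    move=> Gp; rewrite e0 => /admissible_rel0 ->.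
    have := Gp; rewrite e0 => h; have pE := admissible_rel0 h.
    by rewrite pE in h *; apply: equivalent_pairs_refl; exists G.
  split=> [p q|]; first exact: refl.
  exists 0, 0; split=> [|p q]; last exact: refl.
  by split; rewrite ?e0 lie0l ?mul0rn ?oppr0.
have nd := simple_killing_nondeg sL.
have [T [dT iT GE]] := grading_derivation Gg.
rewrite GE in ea ho *.
have hoT : half_optimal T a e.
  by move=> x /(gpartP _ _ iT) xP /centralizerP; apply: ho.
have [h [f [tr h0 _]]] := graded_sl2_triple nd dT iT (lt_trans ltr01 a1) ea en hoT.
split=> [p q Gp Gq|].
  exact: (fixed_grading_equivalent nd dT iT a1 ea hoT e0 Gp Gq).
exists h, f; split=> // p q; rewrite dynkin_egr.
exact: (dynkin_equivalent nd dT iT a1 ea e0 en hoT tr h0).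
Qed.

Theorem mainTheorem5 (R : realType) (L : lieAlgType R[i]) (e : L)
    (b : R) (G : int -> {vspace L}) :
  simple_lie L -> lie_nilpotent e -> 0 < b ->
  is_grading G -> b_optimal b e G ->
  (forall p q : {vspace L} * {vspace L},
     admissible_rel e G p -> admissible_rel e G q -> equivalent_pairs e p q) /\
  (exists h f : L, sl2_triple e h f /\
     forall p q : {vspace L} * {vspace L},
       admissible_rel e G p -> admissible_rel e (dynkin_grading h) q ->
       equivalent_pairs e p q).
Proof.
move=> sL en _ Gg [ho [a [a2 ea ba]]].
apply: (@half_optimal_equivalent _ L e a%:Z G) => // x xP; apply: ho.
elim/in_gsum_ind: xP => [|u v|j u ja uj]; first exact: in_gsum0.
  exact: in_gsumD.
apply: in_gsum_mem uj _.
(* [2 j < - a] and [2 b <= a] give [j < - b]; the comparison takes place in [R], where [b] lives. *)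
have : (j *+ 2)%:~R < (- a%:Z)%:~R :> R by rewrite ltr_int.
by rewrite rmorphMn rmorphN /= -[a%:Z%:~R]/(a%:R); move: ba; clear; lra.
Qed.
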